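(* Let $n\ge 1$, let $\rho$ be a quasi-order on $[1,n]$ and let $\mathcal{A}_\rho \subseteq M_n$ be the corresponding structural matrix algebra. Then the following two statements are equivalent: (i) For each $(i,j) \in \rho$ with $i\neq j$ we have $$\left|(\rho(i) \cup \rho^{-1}(i)) \cap (\rho(j) \cup \rho^{-1}(j))\right| \geq 3.$$ (ii) Every continuous injective commutativity and spectrum preserving map $\phi : \mathcal{A}_\rho \to M_n$ (not assumed linear) is necessarily a Jordan embedding.
   Context: $[1,n]=\{1,\dots,n\}$ and $M_n$ is the algebra of $n\times n$ complex matrices, with its usual topology; $E_{ij}$ are the standard matrix units. A quasi-order on $[1,n]$ is a reflexive transitive relation $\rho\subseteq[1,n]^2$. The structural matrix algebra (SMA) defined by $\rho$ is $\mathcal{A}_\rho=\operatorname{span}\{E_{ij}:(i,j)\in\rho\}\subseteq M_n$, i.e. the set of all $A\in M_n$ with $A_{ij}=0$ whenever $(i,j)\notin\rho$; it is a unital subalgebra of $M_n$. For $x\in[1,n]$, $\rho(x)=\{y:(x,y)\in\rho\}$ and $\rho^{-1}(x)=\{y:(y,x)\in\rho\}$; $|S|$ denotes the cardinality of a set $S$. A map $\phi:\mathcal{A}_\rho\to M_n$ preserves commutativity if $XY=YX$ implies $\phi(X)\phi(Y)=\phi(Y)\phi(X)$ for all $X,Y\in\mathcal{A}_\rho$; it preserves spectrum if for every $X\in\mathcal{A}_\rho$ the set of eigenvalues of $\phi(X)$ equals the set of eigenvalues of $X$. A Jordan embedding is an injective complex-linear map $\phi$ with $\phi(XY+YX)=\phi(X)\phi(Y)+\phi(Y)\phi(X)$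 for all $X,Y$ in its domain. *)

(* Defs.v *)
From HB Require Import structures.
From mathcomp Require Import all_boot all_order all_algebra.
From mathcomp Require Import all_classical all_reals all_analysis.
From mathcomp Require Import complex.

Set Implicit Arguments.
Unset Strict Implicit.
Unset Printing Implicit Defensive.

Import Order.TTheory GRing.Theory Num.Theory.
Import numFieldNormedType.Exports.

Local Open Scope ring_scope.

(* R[i] carries no topology in the libraries.  Every numFieldType F has the
   topology of its norm on F^o; it is copied here, so that R[i], and entrywise
   'M[R[i]]_n, get their usual topologies. *)
HB.instance Definition _ (R : realType) := NormedModule.copy R[i] R[i]^o.

Definition quasi_order (T : Type) (rho : rel T) : Prop :=
  reflexive rho /\ transitive rho.

Definition rimage (T : finType) (rho : rel T) (x : T) : {set T} :=
  [set y | rho x y]%SET.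

Definition rpreimage (T : finType) (rho : rel T) (x : T) : {set T} :=
  [set y | rho y x]%SET.

Definition SMA (R : realType) (n : nat) (rho : rel 'I_n) : set 'M[R[i]]_n :=
  [set A | forall i j, ~~ rho i j -> A i j = 0]%classic.
Arguments SMA R {n} rho.

(* A map defined on a set D of matrices is represented by a function on all of
   'M[R[i]]_n; the predicates below depend only on its restriction to D. *)

Definition preserves_commutativity (R : realType) (n : nat)
    (D : set 'M[R[i]]_n) (phi : 'M[R[i]]_n -> 'M[R[i]]_n) : Prop :=
  forall X Y, D X -> D Y ->
    X *m Y = Y *m X -> phi X *m phi Y = phi Y *m phi X.

(* [eigenvalue] tests for row eigenvectors; the left and right eigenvalues of a
   square matrix coincide. *)
Definition preserves_spectrum (R : realType) (n : nat)
    (D : set 'M[R[i]]_n) (phi : 'M[R[i]]_n -> 'M[R[i]]_n) : Prop :=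
  forall X, D X -> eigenvalue (phi X) =1 eigenvalue X.

Definition linear_on (R : realType) (n : nat)
    (D : set 'M[R[i]]_n) (phi : 'M[R[i]]_n -> 'M[R[i]]_n) : Prop :=
  forall (a : R[i]) X Y, D X -> D Y ->
    phi (a *: X + Y) = a *: phi X + phi Y.

Definition jordan_embedding (R : realType) (n : nat)
    (D : set 'M[R[i]]_n) (phi : 'M[R[i]]_n -> 'M[R[i]]_n) : Prop :=
  [/\ set_inj D phi,
      linear_on D phi &
      forall X Y, D X -> D Y ->
        phi (X *m Y + Y *m X) = phi X *m phi Y + phi Y *m phi X].

(* Main.v *)
(* (i) => (ii).  The hypotheses are stable under conjugation X |-> W^-1 phi(V X V^-1) W
   with V a unit of the algebra.  Since phi(diag(1, .., n)) is diagonalizable and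
   phi preserves commutativity and spectrum, following a segment of diagonal
   matrices with distinct entries gives phi(D) = T D T^-1 for all diagonal D; let
   T = 1.  Then phi(E_ij) lives in the block {i, j} and, by commutation with a unit
   sharing the head or the tail, is a multiple of E_ij or of E_ji, with the same
   alternative throughout a component of rho; transposing some components, suppose
   phi(E_ij) = c_ij E_ij.  Condition (i) puts each E_ij in the span of a chain
   i -> j -> k of distinct indices.  For V in the Heisenberg group of the chain the
   idempotents V E_pp V^-1 satisfy orthogonality relations that are preserved by
   phi; they force a functional equation making phi linear on these idempotents and
   c_ij c_jk = c_ik.  Removing c by a Hadamard automorphism, phi fixes diagonal
   matrices and matrix units, and this property is inherited by all conjugates of phi
   by transvections 1 + t E_ij of the algebra.  Hence the set of matrices fixed by all
   such phi is closed, contains the diagonal matrices and is stable under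
   conjugation by transvections, so it is the whole algebra.
   (ii) => (i).  If only i and j are related to both i and j, then multiplying X_ij
   and dividing X_ji by a positive function of (X_ii - X_jj, X_ij, X_ji), homogeneous
   of degree 0, preserves everything in (ii) but linearity. *)

Require Import Defs.
From HB Require Import structures.
From mathcomp Require Import all_boot all_order all_algebra.
From mathcomp Require Import all_classical all_reals all_analysis.
From mathcomp Require Import complex ring.
Import Order.TTheory GRing.Theory Num.Theory.
Import numFieldNormedType.Exports.
Local Open Scope classical_set_scope.
Local Open Scope ring_scope.

Set Implicit Arguments.
Unset Strict Implicit.
Unset Printing Implicit Defensive.

(** * Continuity along lines *)

Lemma real_complex_continuous (R : realType) :
  continuous (fun t : R => t%:C%C : R[i]).
Proof.
move=> t A /nbhs_ballP[e /= e0 eA].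
(* A positive element of [R[i]] is real, so the complex radius [e] also serves as a radius in
   [R]. *)
have ee : e = (complex.Re e)%:C%C.
  by move: e0; case: e {eA} => x y; rewrite ltcE/= => /andP[/eqP-> _].
apply/nbhs_ballP; exists (complex.Re e) => /=.
  by move: e0; rewrite ltcE /= => /andP[].
move=> s ts; apply: eA; move: ts; rewrite /ball /= => ts.
by rewrite -rmorphB /= normc_def /= expr0n /= addr0 sqrtr_sqr ee ltcR.
Qed.

(** The line stays inside the algebra, where [phi] is continuous, and a neighbourhood of a matrix
    constrains its finitely many entries separately. *)
Lemma line_continuous (R : realType) (n : nat) (rho : rel 'I_n)
    (phi : 'M[R[i]]_n -> 'M[R[i]]_n) (X Y : 'M[R[i]]_n) (i j : 'I_n) :
  {within SMA R rho, continuous phi} -> SMA R rho X -> SMA R rho Y ->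
  continuous (fun t : R => phi (X + t%:C%C *: Y) i j).
Proof.
move=> phi_c AX AY t.
have AXY (s : R) : SMA R rho (X + s%:C%C *: Y).
  by move=> k l kl; rewrite !mxE AX // AY // mulr0 addr0.
move/subspace_continuousP : phi_c => /(_ _ (AXY t)) phi_c.
apply: (@continuous_comp _ _ _ (fun t : R => phi (X + t%:C%C *: Y))
  (fun M : 'M[R[i]]_n => M i j)); last exact: coord_continuous.
apply: cvg_comp phi_c => B [P nP PB].
have : \forall s \near t, forall ij : 'I_n * 'I_n, P ij.1 ij.2 ((X + s%:C%C *: Y) ij.1 ij.2).
  apply: (@filter_forall R ('I_n * 'I_n)%type
    (fun ij s => P ij.1 ij.2 ((X + s%:C%C *: Y) ij.1 ij.2)) (nbhs t)).
  move=> -[k l] /=.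
  have : (fun s : R => (X + s%:C%C *: Y) k l) @ t --> (X + t%:C%C *: Y) k l.
    rewrite (_ : (fun _ => _) = (fun s : R => X k l + s%:C%C * Y k l)); last first.
      by apply/funext => s; rewrite !mxE.
    rewrite !mxE; apply: cvgD; first exact: cvg_cst.
    by apply: cvgM; [exact: real_complex_continuous|exact: cvg_cst].
  exact.
by apply: filterS => s Ps; apply: PB => [i' j'|]; [exact: (Ps (i', j'))|exact: AXY].
Qed.

(* All that is used of continuity; unlike [{within _, continuous _}] it passes
   to conjugates, transposes and Hadamard twists of [phi] entry by entry. *)
Definition line_cont (R : realType) (n : nat) (D : set 'M[R[i]]_n)
    (phi : 'M[R[i]]_n -> 'M[R[i]]_n) : Prop :=
  forall X Y i j, D X -> D Y ->
    continuous (fun t : R => phi (X + t%:C%C *: Y) i j).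

(** The difference between [phi] on the line and the affine function [L + t M] is continuous and
    vanishes at points tending to [0]. Only arbitrarily large [m] are required, so that finitely
    many bad values can be skipped. *)
Lemma line_limit (R : realType) (n : nat) (D : set 'M[R[i]]_n)
    (phi : 'M[R[i]]_n -> 'M[R[i]]_n) (X Y L M : 'M[R[i]]_n) :
  line_cont D phi -> D X -> D Y ->
  (forall N, exists2 m, (N <= m)%N &
     phi (X + m.+1%:R^-1 *: Y) = L + m.+1%:R^-1 *: M) ->
  phi X = L.
Proof.
move=> phi_c DX DY frq; apply/matrixP => i j; apply/eqP; rewrite -subr_eq0.
apply/negPn/negP => ne0.
pose h (t : R) : R[i] := phi (X + t%:C%C *: Y) i j - (L i j + t%:C%C * M i j).
have h_c : continuous h.
  move=> t; apply: cvgB; first exact: phi_c.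
  apply: cvgD; first exact: cvg_cst.
  by apply: cvgM; [exact: real_complex_continuous|exact: cvg_cst].
have h0 : h 0 != 0 by rewrite /h scale0r addr0 mul0r addr0.
have [N _ hN] := @cvg_harmonic R _ (cvgr_neq0 _ (h_c 0) h0).
have [m Nm phim] := frq N.
have /eqP := hN m Nm; apply; rewrite /h /=.
by rewrite fmorphV /= rmorph_nat phim !mxE subrr.
Qed.

(** * Diagonal matrices *)

Lemma eigenvalue_diag (F : fieldType) (n : nat) (d : 'rV[F]_n) (a : F) :
  eigenvalue (diag_mx d) a -> exists i, a = d 0 i.
Proof.
case/eigenvalueP => v vd /rV0Pn[i vi]; exists i.
have /rowP/(_ i) := vd.
by rewrite mul_mx_diag !mxE mulrC => /(mulIf vi).
Qed.

Lemma eigenvalue_diag_entry (F : fieldType) (n : nat) (M : 'M[F]_n) (i : 'I_n) :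
  (forall j, j != i -> M i j = 0) -> eigenvalue M (M i i).
Proof.
move=> Mi; apply/eigenvalueP; exists (delta_mx 0 i).
  rewrite -rowE; apply/rowP => j; rewrite !mxE eqxx /=.
  by have [->|/Mi ->] := eqVneq j i; rewrite ?mulr1 ?mulr0.
by apply/rV0Pn; exists i; rewrite !mxE !eqxx oner_neq0.
Qed.

Section DiagonalSegment.
Variables (R : realType) (n : nat) (rho : rel 'I_n).
Hypothesis rho_refl : reflexive rho.
Local Notation A := (SMA R rho).

Lemma SMA_diag (d : 'rV[R[i]]_n) : A (diag_mx d).
Proof.
move=> i j; rewrite mxE; have [->|] := eqVneq i j; first by rewrite rho_refl.
by rewrite mulr0n.
Qed.

Lemma comm_diag_is_diag (lam : 'rV[R[i]]_n) (M : 'M[R[i]]_n) :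
  injective (lam 0) -> M *m diag_mx lam = diag_mx lam *m M ->
  M = diag_mx (\row_k M k k).
Proof.
move=> lam_inj /matrixP cM; apply/matrixP => i j; rewrite !mxE.
have [->|ij] := eqVneq i j; first by rewrite mulr1n.
rewrite mulr0n; have := cM i j; rewrite mul_mx_diag mul_diag_mx !mxE mulrC.
move/eqP; rewrite -subr_eq0 -mulrBl mulf_eq0 => /orP[|/eqP//].
by rewrite subr_eq0 => /eqP/lam_inj ji; rewrite ji eqxx in ij.
Qed.

Variable phi : 'M[R[i]]_n -> 'M[R[i]]_n.
Hypothesis phi_line : line_cont A phi.
Hypothesis phi_comm : preserves_commutativity A phi.
Hypothesis phi_spec : preserves_spectrum A phi.

Let lam : 'rV[R[i]]_n := \row_k (k : nat)%:R.
Hypothesis phi_lam : phi (diag_mx lam) = diag_mx lam.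

Let lam_inj : injective (lam 0).
Proof. by move=> i j; rewrite !mxE => /eqP; rewrite eqr_nat => /eqP/val_inj. Qed.

Lemma phi_diag_is_diag (d : 'rV[R[i]]_n) :
  phi (diag_mx d) = diag_mx (\row_k phi (diag_mx d) k k).
Proof.
apply: (comm_diag_is_diag lam_inj); rewrite -phi_lam.
by apply: phi_comm; rewrite ?mulmx_diag; first [exact: SMA_diag|
   congr diag_mx; apply/rowP => k; rewrite !mxE mulrC].
Qed.

Lemma phi_diag_entry (d : 'rV[R[i]]_n) (k : 'I_n) :
  exists l, phi (diag_mx d) k k = d 0 l.
Proof.
apply: eigenvalue_diag; rewrite -(phi_spec (SMA_diag d)).
apply: eigenvalue_diag_entry => j jk.
by rewrite phi_diag_is_diag mxE eq_sym (negPf jk) mulr0n.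
Qed.

(* Distinct imaginary parts keep the diagonal entries distinct along the
   segment from [lam], so the entry of [phi] at [k] cannot jump. *)
Lemma phi_diag_segment (d : 'rV[R[i]]_n) :
  injective (fun k => complex.Im (d 0 k)) -> phi (diag_mx d) = diag_mx d.
Proof.
move=> Im_inj.
pose X := diag_mx lam; pose Y := diag_mx (d - lam).
pose e (t : R) : 'rV[R[i]]_n := lam + t%:C%C *: (d - lam).
have XY t : X + t%:C%C *: Y = diag_mx (e t).
  by apply/matrixP => k l; rewrite !mxE; case: (k == l); rewrite ?mulr1n ?mulr0n ?mulr0 ?addr0.
have e_inj t : 0 <= t -> injective (e t 0).
  move=> t0 k l; rewrite /e !mxE => /eqP kl; apply/eqP; move: kl.
  have [->|kl] := eqVneq k l; first by [].
  have [->|t_neq0] := eqVneq t 0.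
    by rewrite !mul0r !addr0 eqr_nat => /eqP/val_inj/eqP; rewrite (negPf kl).
  case: (d 0 k) (d 0 l) (Im_inj k l) => [a b] [a' b'] /= bb.
  rewrite -!(rmorph_nat (real_complex R)) eq_complex /= !mul0r !subr0 !addr0.
  rewrite !add0r => /andP[_ /eqP/(mulfI t_neq0)/bb/eqP]; by rewrite (negPf kl).
apply/matrixP => k l; rewrite phi_diag_is_diag !mxE.
have [_|_] := eqVneq k l; last by rewrite !mulr0n.
rewrite !mulr1n => {l}.
pose f (t : R) : R[i] := phi (X + t%:C%C *: Y) k k.
have AX : A X by exact: SMA_diag.
have AY : A Y by exact: SMA_diag.
have f_c : continuous f by exact: phi_line.
have e_c l : continuous (fun t => e t 0 l).
  move=> t; rewrite /e (_ : (fun _ => _) = (fun t : R => lam 0 l + t%:C%C * (d - lam) 0 l)).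
    apply: cvgD; first exact: cvg_cst.
    by apply: cvgM; [exact: real_complex_continuous|exact: cvg_cst].
  by apply/funext => s; rewrite !mxE.
have fe_c l : continuous (fun t => f t - e t 0 l).
  by move=> t; apply: cvgB; [apply: f_c|apply: e_c].
have open_ne l : open [set t : R | f t - e t 0 l != 0].
  by rewrite openE => t /= ft; exact: (cvgr_neq0 _ (fe_c l t) ft).
(* Connectedness of the segment: the parameters at which the entry follows [e t 0 k] form a
   nonempty, closed and relatively open set. *)
pose S := `[0, 1]%classic `&` [set t : R | f t - e t 0 k = 0].
have S01 : S = `[0, 1]%classic.
  apply: segment_connected.
  - exists 0; split=> /=; first by rewrite in_itv /= lexx ler01.
    by rewrite /f /e scale0r addr0 scale0r addr0 phi_lam mxE eqxx mulr1n subrr.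
  (* [f t] is always one of the entries of [e t], so on the segment being the [k]-th one amounts to
     avoiding the finitely many others, an open condition. *)
  - exists (\bigcap_(l in [set l | l != k]) [set t : R | f t - e t 0 l != 0]).
      rewrite (_ : \bigcap_(l in _) _ = [set t | forall l, l != k -> f t - e t 0 l != 0]) //.
      rewrite openE => t /= ft.
      apply: (@filter_forall R 'I_n (fun l t => l != k -> f t - e t 0 l != 0) (nbhs t)) => l.
      have [->|lk] := eqVneq l k; first by apply: filterE.
      have := open_ne l; rewrite openE => /(_ t (ft l lk)).
      by apply: filterS => s.
    apply/seteqP; split=> t [t01 /= ft]; split=> //.
      move=> l /= lk; rewrite -[f t](subrK (e t 0 k)) ft add0r subr_eq0.
      apply: contra lk => /eqP/(e_inj t) ->//.
      by move: t01; rewrite /= in_itv /= => /andP[].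
    have [l fl] := phi_diag_entry (e t) k.
    have [<-|lk] := eqVneq l k; first by rewrite /= /f XY fl subrr.
    by have := ft l lk; rewrite /= /f XY fl subrr eqxx.
  - exists [set t : R | f t - e t 0 k = 0] => //.
    rewrite -openC (_ : ~` _ = [set t : R | f t - e t 0 k != 0]) //.
    by apply/seteqP; split=> t /= /eqP.
have : S 1 by rewrite S01 /= in_itv /= ler01 lexx.
case=> _ /=; rewrite /f /e XY /e !scale1r [lam + _]addrC subrK.
by move/eqP; rewrite subr_eq0 => /eqP.
Qed.

End DiagonalSegment.

(** Otherwise [p] would have [size p] distinct roots. The conclusion is shaped for the premise of
    [line_limit]. *)
Lemma frequently_nonroot (F : numFieldType) (p : {poly F}) (N : nat) :
  p != 0 -> exists2 m, (N <= m)%N & ~~ root p m.+1%:R^-1.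
Proof.
move=> p0; apply/not_exists2P => all_root.
pose rs : seq F := [seq (N + k).+1%:R^-1 | k <- iota 0 (size p)].
have : (size rs < size p)%N.
  apply: max_poly_roots => //.
    apply/allP => _ /mapP[k _ ->].
    by have [|/negP/negPn] := all_root (N + k)%N; rewrite ?leq_addr.
  rewrite map_inj_uniq ?iota_uniq // => k l /invr_inj/eqP.
  by rewrite eqr_nat eqSS eqn_add2l => /eqP.
by rewrite size_map size_iota ltnn.
Qed.

(** * Operations of the algebra and conjugation *)

Section SMAClosure.
Variables (R : realType) (n : nat) (rho : rel 'I_n).
Hypothesis rho_qo : quasi_order rho.
Local Notation A := (SMA R rho).
Implicit Types X Y V W : 'M[R[i]]_n.

Lemma SMA_line X Y (a : R[i]) : A X -> A Y -> A (X + a *: Y).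
Proof. by move=> AX AY i j ij; rewrite !mxE AX // AY // mulr0 addr0. Qed.

Lemma SMA_add X Y : A X -> A Y -> A (X + Y).
Proof. by move=> AX AY; rewrite -[Y]scale1r; exact: SMA_line. Qed.

Lemma SMA_scale X (a : R[i]) : A X -> A (a *: X).
Proof. by move=> AX i j ij; rewrite mxE AX // mulr0. Qed.

Lemma SMA_sub X Y : A X -> A Y -> A (X - Y).
Proof. by move=> AX AY; rewrite -scaleN1r; exact: SMA_line. Qed.

Lemma SMA_scalar (a : R[i]) : A a%:M.
Proof.
move=> i j; rewrite !mxE; have [->|] := eqVneq i j; last by rewrite mulr0n.
by rewrite (proj1 rho_qo).
Qed.

Lemma SMA_delta (i j : 'I_n) : rho i j -> A (delta_mx i j).
Proof.
move=> ij k l; rewrite mxE; have [->|//] := eqVneq k i.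
by have [->|//] := eqVneq l j; rewrite ij.
Qed.

Lemma SMA_mul X Y : A X -> A Y -> A (X *m Y).
Proof.
move=> AX AY i j ij; rewrite mxE big1 // => k _.
have [ik|/AX ->] := boolP (rho i k); last by rewrite mul0r.
have [kj|/AY ->] := boolP (rho k j); last by rewrite mulr0.
by rewrite ((proj2 rho_qo) _ _ _ ik kj) in ij.
Qed.

End SMAClosure.

Lemma eigenvalue_conj (F : fieldType) (n : nat) (W W' M : 'M[F]_n) :
  W *m W' = 1%:M -> eigenvalue (W' *m M *m W) =1 eigenvalue M.
Proof.
suff imp (V V' N : 'M[F]_n) a : V *m V' = 1%:M -> eigenvalue N a -> eigenvalue (V' *m N *m V) a.
  move=> WW' a; apply/idP/idP; last exact: imp.
  move/(imp W' W _ _ (mulmx1C WW')).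
  by rewrite !mulmxA WW' mul1mx -mulmxA WW' mulmx1.
move=> VV' /eigenvalueP[v vN v0]; apply/eigenvalueP; exists (v *m V).
  by rewrite !mulmxA -[v *m V *m V']mulmxA VV' mulmx1 vN scalemxAl.
by apply: contraNneq v0 => vV; rewrite -[v]mulmx1 -VV' mulmxA vV mul0mx.
Qed.

Lemma conj_cancel (F : fieldType) (n : nat) (W W' M : 'M[F]_n) :
  W *m W' = 1%:M -> W *m (W' *m M *m W) *m W' = M.
Proof. by move=> WW'; rewrite -!mulmxA WW' mulmx1 mulmxA WW' mul1mx. Qed.

Lemma conj_mul (F : fieldType) (n : nat) (W W' M N : 'M[F]_n) :
  W *m W' = 1%:M -> W' *m M *m W *m (W' *m N *m W) = W' *m (M *m N) *m W.
Proof.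
by move=> WW'; rewrite -!mulmxA; congr (_ *m (_ *m _)); rewrite mulmxA WW' mul1mx.
Qed.

Lemma conj_inj (F : fieldType) (n : nat) (W W' M N : 'M[F]_n) :
  W *m W' = 1%:M -> W' *m M *m W = W' *m N *m W -> M = N.
Proof.
move=> WW' MN.
by rewrite -(conj_cancel M WW') -(conj_cancel N WW') MN.
Qed.

Lemma conj_comm (F : fieldType) (n : nat) (W W' M N : 'M[F]_n) :
  W *m W' = 1%:M -> M *m N = N *m M ->
  W' *m M *m W *m (W' *m N *m W) = W' *m N *m W *m (W' *m M *m W).
Proof.
by move=> WW' MN; rewrite (conj_mul M N WW') (conj_mul N M WW') MN.
Qed.

Record admissible (R : realType) (n : nat) (D : set 'M[R[i]]_n)
    (phi : 'M[R[i]]_n -> 'M[R[i]]_n) : Prop := Admissible {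
  adm_line : line_cont D phi;
  adm_inj : set_inj D phi;
  adm_comm : preserves_commutativity D phi;
  adm_spec : preserves_spectrum D phi }.

Lemma continuous_mulmx (R : realType) (n : nat) (f : R -> 'M[R[i]]_n) (B C : 'M[R[i]]_n) :
  (forall i j, continuous (fun t => f t i j)) ->
  forall i j, continuous (fun t => (B *m f t *m C) i j).
Proof.
move=> f_c i j.
rewrite (_ : (fun _ => _) = (fun t => \sum_l (\sum_k B i k * f t k l) * C l j)); last first.
  by apply/funext => t; rewrite mxE; apply: eq_bigr => l _; rewrite mxE.
move=> t; apply: cvg_big => [|l _]; first exact: add_continuous.
apply: cvgM; last exact: cvg_cst.
apply: cvg_big => [|k _]; first exact: add_continuous.
by apply: cvgM; [exact: cvg_cst|exact: f_c].
Qed.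

(** The two conjugations are independent: [V] and its inverse lie in the algebra, whereas [W] is any
    unit of the full matrix ring and serves to normalize the images. *)
Lemma admissible_conj (R : realType) (n : nat) (rho : rel 'I_n)
    (phi : 'M[R[i]]_n -> 'M[R[i]]_n) (V V' W W' : 'M[R[i]]_n) :
  quasi_order rho -> SMA R rho V -> SMA R rho V' ->
  V *m V' = 1%:M -> W *m W' = 1%:M -> admissible (SMA R rho) phi ->
  admissible (SMA R rho) (fun X => W' *m phi (V *m X *m V') *m W).
Proof.
move=> rho_qo AV AV' VV' WW' phi_adm.
have V'V := mulmx1C VV'; have W'W := mulmx1C WW'.
have AVV X : SMA R rho X -> SMA R rho (V *m X *m V').
  by move=> AX; do ?apply: SMA_mul.
split.
- move=> X Y i j AX AY; apply: continuous_mulmx => k l.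
  rewrite (_ : (fun _ => _) = (fun t : R => phi (V *m X *m V' + t%:C%C *: (V *m Y *m V')) k l)).
    by apply: (adm_line phi_adm); exact: AVV.
  by apply/funext => t; rewrite mulmxDr mulmxDl -scalemxAr -scalemxAl.
- move=> X Y AX AY /(conj_inj WW') /(adm_inj phi_adm) eqXY.
  by apply: (conj_inj V'V); apply: eqXY; apply/mem_set/AVV/set_mem.
- move=> X Y AX AY XY; apply: (conj_comm WW').
  by apply: (adm_comm phi_adm (AVV _ AX) (AVV _ AY)); apply: (conj_comm V'V).
- move=> X AX a; rewrite (eigenvalue_conj _ WW') (adm_spec phi_adm (AVV _ AX)).
  exact: eigenvalue_conj V'V a.
Qed.

(** * Normalization on the diagonal matrices *)

Lemma distinct_eigenvalues_diag (F : fieldType) (n : nat) (M : 'M[F]_n) (lam : 'rV[F]_n) :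
  injective (lam 0) -> (forall k, eigenvalue M (lam 0 k)) ->
  exists2 U, U \in unitmx & U *m M = diag_mx lam *m U.
Proof.
move=> lam_inj eigM.
have /choice[v vP] (k : 'I_n) : exists v : 'rV[F]_n,
    v *m M = lam 0 k *: v /\ v != 0.
  by case/eigenvalueP: (eigM k) => v vE v0; exists v.
pose U : 'M[F]_n := \matrix_(k, l) v k 0 l.
have rowU k : row k U = v k by apply/rowP => l; rewrite !mxE.
have UM : U *m M = diag_mx lam *m U.
  apply/row_matrixP => k; rewrite row_mul rowU (proj1 (vP k)).
  by apply/rowP => l; rewrite mul_diag_mx !mxE.
exists U => //.
rewrite -row_free_unit -kermx_eq0; apply/eqP/row_matrixP => r; rewrite row0.
set w := row r _; have : w *m U = 0 by apply/sub_kermxP; exact: row_sub.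
move: w => {r} w wU; apply/rowP => k; rewrite mxE.
(* Since [U M = diag lam U], the rows killed by [U] are stable under [diag_mx lam], hence under
   polynomials in it. The product over all [j] other than [k] then isolates the coefficient of [w]
   at [k]. *)
have kill (s : seq 'I_n) :
    (\row_l (w 0 l * \prod_(j <- s) (lam 0 l - lam 0 j))) *m U = 0.
  elim: s => [|j s IH].
    by rewrite -[RHS]wU; congr mulmx; apply/rowP => l; rewrite mxE big_nil mulr1.
  move: IH; set u := \row_l _ => uU.
  have -> : \row_l (w 0 l * \prod_(i0 <- j :: s) (lam 0 l - lam 0 i0)) =
            u *m diag_mx lam - lam 0 j *: u.
    by apply/rowP => l; rewrite mul_mx_diag !mxE big_cons; ring.
  by rewrite mulmxBl -mulmxA -UM mulmxA uU mul0mx -scalemxAl uU scaler0 subr0.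
have := kill [seq j <- enum 'I_n | j != k].
set u := \row_l _; have -> : u = u 0 k *: delta_mx 0 k.
  apply/rowP => l; rewrite !mxE eqxx /= eq_sym.
  have [->|lk] := eqVneq l k; first by rewrite mulr1.
  rewrite mulr0 (bigD1_seq l) /=; first last.
  - by rewrite filter_uniq ?enum_uniq.
  - by rewrite mem_filter lk mem_enum.
  by rewrite subrr mul0r mulr0.
rewrite -scalemxAl -rowE rowU => /eqP; rewrite scaler_eq0 (negPf (proj2 (vP k))) orbF mxE.
rewrite mulf_eq0 => /orP[/eqP //|]; rewrite big_filter => /negPn/negP[].
rewrite prodf_seq_neq0; apply/allP => j _; apply/implyP => jk.
by rewrite subr_eq0; apply: contraNneq jk => /lam_inj ->.
Qed.

(** Distinct imaginary parts are handled by [phi_diag_segment]. A general [d] is approached in the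
    direction ['i%C *: lam], where all but finitely many points have them. *)
Lemma admissible_diag_id (R : realType) (n : nat) (rho : rel 'I_n)
    (phi : 'M[R[i]]_n -> 'M[R[i]]_n) (d : 'rV[R[i]]_n) :
  quasi_order rho -> admissible (SMA R rho) phi ->
  phi (diag_mx (\row_k (k : nat)%:R)) = diag_mx (\row_k (k : nat)%:R) ->
  phi (diag_mx d) = diag_mx d.
Proof.
move=> [rho_refl _] [phi_line _ phi_comm phi_spec] phi_lam.
set lam := \row_k _ in phi_lam.
pose y : 'rV[R[i]]_n := 'i%C *: lam.
apply: (line_limit (D := SMA R rho) (Y := diag_mx y) (M := diag_mx y)) => //;
  try exact: SMA_diag.
move=> N.
pose c (kl : 'I_n * 'I_n) : R[i] := (complex.Im (d 0 kl.1) - complex.Im (d 0 kl.2))%:C%C.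
(* At a real [e], [q (k, l)] takes as value the difference of the imaginary parts of entries [k] and
   [l] of [d + e y]; a real nonroot of [p] separates all of them. *)
pose q kl : {poly R[i]} := (c kl)%:P + (kl.1%:R - kl.2%:R) *: 'X.
pose p := \prod_(kl | kl.1 != kl.2) q kl.
have p0 : p != 0.
  apply/prodf_neq0 => -[k l] /= kl; apply/eqP => /polyP/(_ 1).
  rewrite /q coefD coefC coefZ coefX coef0 /= mulr1 add0r => /eqP.
  by rewrite subr_eq0 eqr_nat => /eqP/val_inj/eqP; rewrite (negPf kl).
have [m Nm root_m] := frequently_nonroot N p0; exists m => //.
set e : R[i] := _^-1 in root_m *.
have ee : e = (m.+1%:R^-1)%:C%C by rewrite /e fmorphV /= rmorph_nat.
have -> : diag_mx d + e *: diag_mx y = diag_mx (d + e *: y).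
  apply/matrixP => k l; rewrite !mxE; case: (k == l); rewrite ?mulr1n ?mulr0n ?mulr0 ?addr0 //.
have ImE k : complex.Im ((d + e *: y) 0 k) = complex.Im (d 0 k) + m.+1%:R^-1 * k%:R.
  rewrite !mxE ee -(rmorph_nat (real_complex R)).
  by case: (d 0 k) => a b /=; ring.
apply: (@phi_diag_segment R n rho) => // k l; rewrite !ImE => E.
apply/eqP/negPn/negP => kl.
move: root_m; rewrite /p /root horner_prod => /prodf_neq0 /(_ (k, l) kl).
rewrite /q hornerD hornerC hornerZ hornerX /c /= ee -!(rmorph_nat (real_complex R)).
rewrite -rmorphB -rmorphM -rmorphD /= fmorph_eq0 => /eqP; apply.
by rewrite mulrBl ![_%:R * _]mulrC addrACA -opprD E subrr.
Qed.

(** [phi (diag_mx lam)] has the [n] distinct entries of [lam] as eigenvalues, so it is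
    diagonalizable; conjugating the target by its eigenvector matrix [U] reduces to
    [admissible_diag_id]. *)
Lemma admissible_diag (R : realType) (n : nat) (rho : rel 'I_n)
    (phi : 'M[R[i]]_n -> 'M[R[i]]_n) :
  quasi_order rho -> admissible (SMA R rho) phi ->
  exists T T' : 'M[R[i]]_n, T *m T' = 1%:M /\
    forall d, phi (diag_mx d) = T *m diag_mx d *m T'.
Proof.
move=> rho_qo phi_adm; set lam : 'rV[R[i]]_n := \row_k (k : nat)%:R.
have Alam : SMA R rho (diag_mx lam) by apply: SMA_diag; case: rho_qo.
have [||U Uunit Uphi] := @distinct_eigenvalues_diag _ _ (phi (diag_mx lam)) lam.
- by move=> i j; rewrite !mxE => /eqP; rewrite eqr_nat => /eqP/val_inj.
- move=> k; rewrite (adm_spec phi_adm) //.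
  have -> : lam 0 k = diag_mx lam k k by rewrite !mxE eqxx mulr1n.
  by apply: eigenvalue_diag_entry => j jk; rewrite mxE eq_sym (negPf jk).
have A1 := SMA_scalar rho_qo (1 : R[i]).
have psi_adm := admissible_conj rho_qo A1 A1 (mulmx1 1%:M) (mulVmx Uunit) phi_adm.
have psi_lam : U *m phi (1%:M *m diag_mx lam *m 1%:M) *m invmx U = diag_mx lam.
  by rewrite mulmx1 mul1mx Uphi -mulmxA mulmxV // mulmx1.
exists (invmx U), U; split=> [|d]; first exact: mulVmx.
have := admissible_diag_id d rho_qo psi_adm psi_lam.
rewrite mulmx1 mul1mx => E; rewrite -[in RHS]E.
exact: esym (conj_cancel _ (mulVmx Uunit)).
Qed.

(** * Chains of three indices *)

Section Heisenberg.
Variables (F : numFieldType) (n : nat) (i j k : 'I_n).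
Hypotheses (ij : i != j) (ik : i != k) (jk : j != k).
Implicit Types (a b c : F) (Z : 'M[F]_n).
Local Notation E := delta_mx.

Lemma mulmx_delta Z (u v p q : 'I_n) : (Z *m E u v) p q = Z p u * (q == v)%:R.
Proof.
rewrite mxE (bigD1 u) //= big1 ?addr0 => [|w wu]; first by rewrite mxE eqxx.
by rewrite mxE (negPf wu) mulr0.
Qed.

Lemma delta_mulmx Z (u v p q : 'I_n) : (E u v *m Z) p q = (p == u)%:R * Z v q.
Proof.
rewrite mxE (bigD1 v) //= big1 ?addr0 => [|w wv]; first by rewrite mxE eqxx andbT.
by rewrite mxE (negPf wv) andbF mul0r.
Qed.

Lemma diag_delta (m : 'I_n) : diag_mx (E 0 m) = E m m :> 'M[F]_n.
Proof.
apply/matrixP => p q; rewrite !mxE eqxx /=.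
have [->|pq] := eqVneq p q; first by rewrite andbb.
by rewrite mulr0n; case: eqP => //= <-; rewrite eq_sym (negPf pq).
Qed.

(** Unipotent matrices, upper triangular for the order [i], [j], [k]. In the inverse [heisV], the
    term [a * c] compensates the product term of the group law. *)
Definition heis a b c : 'M[F]_n := 1%:M + a *: E i j + b *: E i k + c *: E j k.
Definition heisV a b c : 'M[F]_n := heis (- a) (a * c - b) (- c).

(* The signs are such that [idem1 a b], [idem2 a c] and [idem3 (b - a * c) c] are
   the conjugates of [E i i], [E j j] and [E k k] by the same [heis a b c]. *)
Definition idem1 a b : 'M[F]_n := E i i + a *: E i j + b *: E i k.
Definition idem2 a c : 'M[F]_n := E j j - a *: E i j + c *: E j k - (a * c) *: E i k.
Definition idem3 b c : 'M[F]_n := E k k - b *: E i k - c *: E j k.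

Let neqs := (negPf ij, negPf ik, negPf jk).
Let neqs' : ((j == i) = false) * ((k == i) = false) * ((k == j) = false).
Proof. by rewrite !(eq_sym _ i) (eq_sym k) !neqs. Qed.

Let mulE := (mulmxDl, mulmxDr, mulmxBl, mulmxBr, mul1mx, mulmx1, =^~ scalemxAl,
  =^~ scalemxAr, mul_delta_mx_cond).
Let simpE := (eqxx, neqs, neqs', mulr0n, mulr1n, mul0mx, mulmx0, scaler0, addr0,
  add0r, subr0).

Lemma heisVK a b c : heisV a b c *m heis a b c = 1%:M.
Proof.
rewrite /heisV /heis !mulE !simpE.
by apply/matrixP => p q; rewrite !mxE; ring.
Qed.

Lemma heis_idem1 a b c : heisV a b c *m E i i *m heis a b c = idem1 a b.
Proof.
rewrite /heisV /heis /idem1 !mulE !simpE ?mulE ?simpE.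
by apply/matrixP => p q; rewrite !mxE; ring.
Qed.

Lemma heis_idem2 a b c : heisV a b c *m E j j *m heis a b c = idem2 a c.
Proof.
rewrite /heisV /heis /idem2 !mulE !simpE ?mulE ?simpE.
by apply/matrixP => p q; rewrite !mxE; ring.
Qed.

Lemma heis_idem3 a b c : heisV a b c *m E k k *m heis a b c = idem3 (b - a * c) c.
Proof.
rewrite /heisV /heis /idem3 !mulE !simpE ?mulE ?simpE.
by apply/matrixP => p q; rewrite !mxE; ring.
Qed.

Lemma heis_other a b c (m : 'I_n) : m != i -> m != j -> m != k ->
  heisV a b c *m E m m *m heis a b c = E m m.
Proof.
move=> mi mj mk; rewrite /heisV /heis !mulE !(eq_sym _ m).
by rewrite (negPf mi) (negPf mj) (negPf mk) !simpE.
Qed.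

(** Commutation with [E i k] makes the block on [i], [j], [k] upper triangular with equal corners
    [Z i i] and [Z k k]. Idempotence and trace one leave only [Z j j = 1] on the diagonal, and
    idempotence then gives [Z i k = Z i j * Z j k]. *)
Lemma idem2_shape Z : Z *m Z = Z -> \tr Z = 1 -> Z *m E i k = E i k *m Z ->
  (forall m, m != i -> m != j -> m != k -> Z *m E m m = 0 /\ E m m *m Z = 0) ->
  Z = idem2 (- Z i j) (Z j k).
Proof.
move=> ZZ trZ /matrixP Zik Zm.
have Z_m p m : m != i -> m != j -> m != k -> Z p m = 0.
  move=> mi mj mk; have [/matrixP/(_ p m) + _] := Zm m mi mj mk.
  by rewrite mulmx_delta eqxx mulr1 mxE.
have Zm_ p m : m != i -> m != j -> m != k -> Z m p = 0.
  move=> mi mj mk; have [_ /matrixP/(_ m p)] := Zm m mi mj mk.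
  by rewrite delta_mulmx eqxx mul1r mxE.
have Z_i p : p != i -> Z p i = 0.
  move=> pi; have := Zik p k.
  by rewrite mulmx_delta delta_mulmx eqxx (negPf pi) mulr1 mul0r.
have Zk_ p : p != k -> Z k p = 0.
  move=> pk; have := Zik i p.
  by rewrite mulmx_delta delta_mulmx eqxx (negPf pk) mulr0 mul1r.
have Zikk : Z i i = Z k k.
  by have := Zik i k; rewrite mulmx_delta delta_mulmx !eqxx mulr1 mul1r.
have ZZE p q : Z p q = Z p i * Z i q + Z p j * Z j q + Z p k * Z k q.
  rewrite -[in LHS]ZZ mxE (bigD1 i) //= (bigD1 j) ?neqs' //= (bigD1 k) ?neqs' //=.
  rewrite big1 ?addr0 ?addrA // => m /andP[/andP[mi mj] mk].
  by rewrite Z_m // mul0r.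
have tr3 : Z i i + Z j j + Z k k = 1.
  rewrite -trZ /mxtrace (bigD1 i) //= (bigD1 j) ?neqs' //= (bigD1 k) ?neqs' //=.
  rewrite big1 ?addr0 ?addrA // => m /andP[/andP[mi mj] mk].
  by rewrite Z_m.
have idem (x : F) : x = x * x -> x = 0 \/ x = 1.
  move=> xx; have /eqP : x * (x - 1) = 0 by rewrite mulrBr mulr1 -xx subrr.
  by rewrite mulf_eq0 subr_eq0 => /orP[/eqP|/eqP]; [left|right].
have Zji : Z j i = 0 by rewrite Z_i ?neqs'.
have Zki : Z k i = 0 by rewrite Z_i ?neqs'.
have Zkj : Z k j = 0 by rewrite Zk_.
(* Diagonal entries are [0] or [1]; if both corners were [1], the trace would be [2] or [3]. *)
have Zii0 : Z i i = 0.
  have /idem[//|Zii1] : Z i i = Z i i * Z i i.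
    by rewrite {1}ZZE Zji Zki !mulr0 !addr0.
  have /idem[] : Z j j = Z j j * Z j j.
    by rewrite {1}ZZE Zji Zkj mulr0 mul0r add0r addr0.
    move=> Zjj; move: tr3; rewrite -Zikk Zjj Zii1 addr0 => /eqP.
    by rewrite -subr_eq0 addrK oner_eq0.
  move=> Zjj; move: tr3; rewrite -Zikk Zjj Zii1 => /eqP.
  by rewrite -subr_eq0 addrK -mulr2n pnatr_eq0.
have Zjj : Z j j = 1 by rewrite -tr3 -Zikk Zii0 add0r addr0.
have Zik' : Z i k = Z i j * Z j k.
  by rewrite {1}ZZE -Zikk Zii0 mul0r mulr0 add0r addr0.
have cases p : [\/ p = i, p = j, p = k | [/\ p != i, p != j & p != k]].
  have [->|pi] := eqVneq p i; first by constructor 1.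
  have [->|pj] := eqVneq p j; first by constructor 2.
  by have [->|pk] := eqVneq p k; [constructor 3|constructor 4].
apply/matrixP => p q; rewrite /idem2 !mxE.
case: (cases p) => [->|->|->|[pi pj pk]]; last first.
  by rewrite Zm_ // (negPf pi) (negPf pj) !mulr0 !(addr0, subr0).
all: case: (cases q) => [->|->|->|[qi qj qk]];
  rewrite ?(Z_m _ q) // ?(negPf qi) ?(negPf qj) ?(negPf qk) !simpE /=
   ?Zji ?Zki ?Zkj ?Zii0 ?Zjj ?Zik' -?Zikk ?Zii0; ring.
Qed.

Lemma idem1_shape Z : \tr Z = 1 -> (forall p q, p != i -> Z p q = 0) ->
  (forall m, m != i -> m != j -> m != k -> Z *m E m m = 0) ->
  Z = idem1 (Z i j) (Z i k).
Proof.
move=> trZ Zp Zm.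
have Zii : Z i i = 1.
  by rewrite -trZ /mxtrace (bigD1 i) //= big1 ?addr0 // => p; exact: Zp.
apply/matrixP => p q; rewrite /idem1 !mxE.
have [->|pi] := eqVneq p i; last by rewrite Zp // !mulr0 !addr0.
have [->|qi] := eqVneq q i; first by rewrite Zii !simpE /=; ring.
have [->|qj] := eqVneq q j; first by rewrite !simpE /=; ring.
have [->|qk] := eqVneq q k; first by rewrite !simpE /=; ring.
have /matrixP/(_ i q) := Zm q qi qj qk; rewrite mulmx_delta eqxx mulr1 mxE => ->.
by rewrite !mulr0 !addr0.
Qed.

Lemma idem3_shape Z : \tr Z = 1 -> (forall p q, q != k -> Z p q = 0) ->
  (forall m, m != i -> m != j -> m != k -> E m m *m Z = 0) ->
  Z = idem3 (- Z i k) (- Z j k).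
Proof.
move=> trZ Zq Zm.
have Zkk : Z k k = 1.
  by rewrite -trZ /mxtrace (bigD1 k) //= big1 ?addr0 // => p; exact: Zq.
apply/matrixP => p q; rewrite /idem3 !mxE.
have [->|qk] := eqVneq q k; last by rewrite Zq // !andbF !mulr0 !subr0.
have [->|pk] := eqVneq p k; first by rewrite Zkk !simpE /=; ring.
have [->|pj] := eqVneq p j; first by rewrite !simpE /=; ring.
have [->|pi] := eqVneq p i; first by rewrite !simpE /=; ring.
have /matrixP/(_ p k) := Zm p pi pj pk; rewrite delta_mulmx eqxx mul1r mxE => ->.
by rewrite !mulr0 !subr0.
Qed.

End Heisenberg.

(** Distributes an entry over linear operations only: unlike [mxE] it keeps matrix products folded,
    for [mulmx_delta] and [delta_mulmx]. *)
Lemma mx_entryE (R : pzRingType) (m n : nat) (p : 'I_m) (q : 'I_n) :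
  (forall A B : 'M[R]_(m, n), (A + B) p q = A p q + B p q) *
  (forall A : 'M[R]_(m, n), (- A) p q = - A p q) *
  (forall a (A : 'M[R]_(m, n)), (a *: A) p q = a * A p q).
Proof. by split; [split|] => *; rewrite mxE. Qed.

(* Orthogonality of [Z1 a b], [Z2 a c] for all [c] and of [Z2 a c],
   [Z3 (b - a * c) c] for all [a] separates the parameters; [Z1 *m Z3 = 0] then
   reads [g b = al a * ga c + g (b - a * c)]. *)
Lemma heis_idempotents (F : numFieldType) (n : nat) (i j k : 'I_n)
    (Z1 Z2 Z3 : F -> F -> 'M[F]_n) :
  i != j -> i != k -> j != k ->
  (forall a b, \tr (Z1 a b) = 1) -> (forall a c, \tr (Z2 a c) = 1) ->
  (forall b c, \tr (Z3 b c) = 1) ->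
  (forall a c, Z2 a c *m Z2 a c = Z2 a c) ->
  (forall a b c, Z1 a b *m Z2 a c = 0 /\ Z2 a c *m Z1 a b = 0) ->
  (forall a b c, Z1 a b *m Z3 (b - a * c) c = 0 /\ Z3 (b - a * c) c *m Z1 a b = 0) ->
  (forall a b c, Z2 a c *m Z3 (b - a * c) c = 0 /\ Z3 (b - a * c) c *m Z2 a c = 0) ->
  (forall m, m != i -> m != j -> m != k -> forall a b,
    [/\ Z1 a b *m delta_mx m m = 0, delta_mx m m *m Z1 a b = 0,
        Z2 a b *m delta_mx m m = 0, delta_mx m m *m Z2 a b = 0 &
        Z3 a b *m delta_mx m m = 0 /\ delta_mx m m *m Z3 a b = 0]) ->
  Z1 0 0 = delta_mx i i -> Z2 0 0 = delta_mx j j -> Z3 0 0 = delta_mx k k ->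
  (forall a c, Z2 a c *m delta_mx i k = delta_mx i k *m Z2 a c) ->
  (Z2 1 0 != Z2 0 0) -> (Z2 0 1 != Z2 0 0) ->
  exists al ga g : F -> F,
    [/\ forall a b, Z1 a b = idem1 i j k (al a) (g b),
        forall a c, Z2 a c = idem2 i j k (al a) (ga c),
        forall b c, Z3 b c = idem3 i j k (g b) (ga c),
        forall a c, g (a * c) = al a * ga c &
        {morph g : x y / x + y}].
Proof.
move=> ij ik jk tr1 tr2 tr3 m22 m12 m13 m23 mo Z100 Z200 Z300 cik Z210 Z201.
have ji : (j == i) = false by rewrite eq_sym (negPf ij).
have ki : (k == i) = false by rewrite eq_sym (negPf ik).
have kj : (k == j) = false by rewrite eq_sym (negPf jk).
have Z2E a c : Z2 a c = idem2 i j k (- Z2 a c i j) (Z2 a c j k).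
  apply: idem2_shape => // m mi mj mk.
  by have [_ _ ? ?] := mo m mi mj mk a c.
have mulP2 (Z : 'M[F]_n) a c p : (Z *m idem2 i j k a c) p j = Z p j - a * Z p i.
  rewrite /idem2 !mulmxBr mulmxDr mulmxBr -!scalemxAr.
  by rewrite !mx_entryE !mulmx_delta !eqxx (negPf jk) /=; ring.
have P2mul (Z : 'M[F]_n) a c p : (idem2 i j k a c *m Z) j p = Z j p + c * Z k p.
  rewrite /idem2 !mulmxBl mulmxDl mulmxBl -!scalemxAl.
  by rewrite !mx_entryE !delta_mulmx !eqxx ji /=; ring.
pose al a := - Z2 a 0 i j; pose ga c := Z2 0 c j k.
have al0 : al 0 = 0 by rewrite /al Z200 mxE eqxx (negPf ij) oppr0.
have ga0 : ga 0 = 0 by rewrite /ga Z200 mxE eqxx kj andbF.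
have Z1m a b p : p != i -> p != j -> p != k -> forall q, Z1 a b p q = 0.
  move=> pi pj pk q; have [_ /matrixP/(_ p q) + _ _ _] := mo p pi pj pk a b.
  by rewrite delta_mulmx eqxx mul1r mxE.
have Z1row_j a b c q : Z1 a b j q + Z2 a c j k * Z1 a b k q = 0.
  have [_ /matrixP/(_ j q)] := m12 a b c.
  by rewrite [X in X *m Z1 _ _]Z2E P2mul mxE.
have Z1ii a b : (forall q, Z1 a b k q = 0) ->
    Z1 a b i i = 1 /\ (forall p q, p != i -> Z1 a b p q = 0).
  move=> Zk; have Zp p q : p != i -> Z1 a b p q = 0.
    move=> pi; have [->|pj] := eqVneq p j.
      by have := Z1row_j a b 0 q; rewrite Zk mulr0 addr0.
    by have [->//|pk] := eqVneq p k; exact: Z1m.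
  split=> //; rewrite -(tr1 a b) /mxtrace (bigD1 i) //= big1 ?addr0 // => p; exact: Zp.
(* For zero second arguments [Z3] is [E k k], so row [k] of [Z1 a 0] vanishes. Then [Z1 a 0 i j] is
   the opposite of [Z2 a c' i j] for every [c'], which is therefore independent of [c']. *)
have alE a c : Z2 a c i j = - al a.
  have [|Zii Zp] := Z1ii a 0.
    move=> q; have [_ /matrixP/(_ k q)] := m13 a 0 0.
    by rewrite mulr0 subr0 Z300 delta_mulmx eqxx mul1r mxE.
  have Zij c' : Z1 a 0 i j = - Z2 a c' i j.
    have [/matrixP/(_ i j) + _] := m12 a 0 c'.
    by rewrite [X in _ *m X]Z2E mulP2 Zii mulr1 mxE => /eqP; rewrite subr_eq0 => /eqP.
  by rewrite /al opprK -[LHS]opprK -Zij (Zij 0) opprK.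
(* The pair [(b, c)] is fixed while [a] varies: [a = 0] kills column [j] of [Z3], and [a = 1] will
   kill column [i] once [al 1] is known to be nonzero. *)
have Z3col b c p a : Z3 b c p j = al a * Z3 b c p i.
  have [_ /matrixP/(_ p j)] := m23 a (b + a * c) c.
  rewrite addrK Z2E mulP2 mxE alE opprK => /eqP; rewrite subr_eq0 => /eqP //.
have Z3j b c p : Z3 b c p j = 0 by rewrite (Z3col b c p 0) al0 mul0r.
have Z2E1 a c : Z2 a c = idem2 i j k (al a) (Z2 a c j k) by rewrite {1}Z2E alE opprK.
(* The mirror image of [alE], starting from [Z1 0 0 = E i i], which kills column [i] of [Z3 0 c]. *)
have gaE a c : Z2 a c j k = ga c.
  have Z3i p : Z3 0 c p i = 0.
    have [_ /matrixP/(_ p i)] := m13 0 0 c.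
    by rewrite mul0r subr0 Z100 mulmx_delta eqxx mulr1 mxE.
  have Z3kk : Z3 0 c k k = 1.
    rewrite -(tr3 0 c) /mxtrace (bigD1 k) //= big1 ?addr0 // => p pk.
    have [->//|pi] := eqVneq p i; have [->//|pj] := eqVneq p j.
    have [_ _ _ _ [_ /matrixP/(_ p p)]] := mo p pi pj pk 0 c.
    by rewrite delta_mulmx eqxx mul1r mxE.
  have Z2jk a' : Z2 a' c j k = - Z3 0 c j k.
    have [/matrixP/(_ j k) + _] := m23 a' (a' * c) c.
    by rewrite subrr [X in X *m _]Z2E1 P2mul Z3kk mulr1 mxE addrC => /eqP; rewrite addr_eq0 => /eqP.
  by rewrite /ga !Z2jk.
have Z2E2 a c : Z2 a c = idem2 i j k (al a) (ga c) by rewrite {1}Z2E1 gaE.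
have al1 : al 1 != 0.
  by apply: contra Z210 => /eqP al1; rewrite !Z2E2 al1 al0.
have ga1 : ga 1 != 0.
  by apply: contra Z201 => /eqP ga1; rewrite !Z2E2 ga1 ga0.
(* Comparing the row relation at [c = 0] and [c = 1] separates rows [j] and [k] of [Z1]. *)
have Z1k a b q : Z1 a b k q = 0.
  have := Z1row_j a b 0 q; rewrite gaE ga0 mul0r addr0 => Zj.
  by have := Z1row_j a b 1 q; rewrite gaE Zj add0r => /eqP; rewrite mulf_eq0 (negPf ga1) => /eqP.
have Z1E a b : Z1 a b = idem1 i j k (al a) (Z1 a b i k).
  have [Zii Zp] := Z1ii a b (Z1k a b).
  have <- : Z1 a b i j = al a.
    have [/matrixP/(_ i j) + _] := m12 a b 0.
    by rewrite Z2E2 mulP2 Zii mulr1 mxE => /eqP; rewrite subr_eq0 => /eqP.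
  by apply: idem1_shape => // m mi mj mk; have [] := mo m mi mj mk a b.
have Z3i b c p : Z3 b c p i = 0.
  by have /esym/eqP := Z3col b c p 1; rewrite Z3j mulf_eq0 (negPf al1) => /eqP.
have Z3q b c p q : q != k -> Z3 b c p q = 0.
  move=> qk; have [->|qi] := eqVneq q i; first exact: Z3i.
  have [->|qj] := eqVneq q j; first exact: Z3j.
  have [_ _ _ _ [/matrixP/(_ p q) + _]] := mo q qi qj qk b c.
  by rewrite mulmx_delta eqxx mulr1 mxE.
have Z3kk b c : Z3 b c k k = 1.
  by rewrite -(tr3 b c) /mxtrace (bigD1 k) //= big1 ?addr0 // => p pk; exact: Z3q.
have Z3E b c : Z3 b c = idem3 i j k (- Z3 b c i k) (ga c).
  have -> : ga c = - Z3 b c j k.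
    have [/matrixP/(_ j k) + _] := m23 0 b c.
    rewrite mul0r subr0 Z2E2 P2mul Z3kk mulr1 mxE addrC => /eqP.
    by rewrite addr_eq0 => /eqP.
  apply: idem3_shape => //; first exact: Z3q.
  by move=> m mi mj mk; have [_ _ _ _ []] := mo m mi mj mk b c.
have Z13 a b c : Z1 a b i k = al a * ga c - Z3 (b - a * c) c i k.
  have [/matrixP/(_ i k) + _] := m13 a b c.
  rewrite [X in X *m _]Z1E /idem1 !mulmxDl -!scalemxAl !mx_entryE !delta_mulmx !eqxx /= Z3kk mxE.
  have -> : Z3 (b - a * c) c j k = - ga c.
    rewrite Z3E /idem3 !mx_entryE !mxE !eqxx (negPf jk) (eq_sym j i) (negPf ij) /=; ring.
  by rewrite !mul1r mulr1 mulrN addrC => /eqP; rewrite addr_eq0 => /eqP ->; ring.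
pose g b := Z1 0 b i k.
have gE b c : Z3 b c i k = - g b.
  by rewrite /g (Z13 0 b c) al0 mul0r mul0r sub0r opprK subr0.
have Z1g a b : Z1 a b i k = g b.
  by rewrite (Z13 a b 0) ga0 !mulr0 subr0 sub0r gE opprK.
have gB a b c : g b = al a * ga c + g (b - a * c).
  by rewrite -(Z1g a) (Z13 a b c) gE opprK.
have g0 : g 0 = 0 by rewrite /g Z100 mxE ki andbF.
have gM a c : g (a * c) = al a * ga c by rewrite (gB a _ c) subrr g0 addr0.
exists al, ga, g; split=> //.
- by move=> a b; rewrite Z1E Z1g.
- by move=> b c; rewrite Z3E gE opprK.
(* The functional equation with [a = x], [c = 1] splits [x] off, since [al x * ga 1 = g x]. *)
- move=> x y; rewrite (gB x (x + y) 1) mulr1 [x + y]addrC addrK.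
  by rewrite -gM mulr1.
Qed.

Lemma scaled_delta (F : numFieldType) (n : nat) (x : F) (p : 'I_n) :
  x *: delta_mx p p = diag_mx (x *: delta_mx 0 p) :> 'M[F]_n.
Proof.
rewrite -diag_delta; apply/matrixP => u v; rewrite !mxE.
by case: (u == v); rewrite ?mulr1n ?mulr0n ?mulr0.
Qed.

Section ConjIdempotents.
Variables (F : fieldType) (n : nat) (T T' : 'M[F]_n).
Hypothesis TT' : T *m T' = 1%:M.

Lemma conj_delta_trace (p : 'I_n) : \tr (T *m delta_mx p p *m T') = 1.
Proof.
rewrite mxtrace_mulC mulmxA (mulmx1C TT') mul1mx /mxtrace (bigD1 p) //= mxE !eqxx big1 ?addr0 //.
by move=> q qp; rewrite mxE (negPf qp).
Qed.

Lemma conj_delta_mul (p q : 'I_n) :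
  T *m delta_mx p p *m T' *m (T *m delta_mx q q *m T') =
  (p == q)%:R *: (T *m delta_mx p p *m T').
Proof.
rewrite (conj_mul _ _ (mulmx1C TT')) mul_delta_mx_cond.
have [->|_] := eqVneq p q; first by rewrite mulr1n scale1r.
by rewrite mulr0n mulmx0 mul0mx scale0r.
Qed.

Lemma conj_scale (x : F) (M : 'M[F]_n) : T *m (x *: M) *m T' = x *: (T *m M *m T').
Proof. by rewrite -scalemxAr -scalemxAl. Qed.

Lemma conj_diag_sum (d : 'rV[F]_n) :
  T *m diag_mx d *m T' = \sum_m d 0 m *: (T *m delta_mx m m *m T').
Proof.
have -> : diag_mx d = \sum_m d 0 m *: delta_mx m m.
  apply/matrixP => p q; rewrite mxE summxE (bigD1 p) //= big1 ?addr0; last first.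
    by move=> m mp; rewrite !mxE eq_sym (negPf mp) mulr0.
  by rewrite !mxE eqxx /= (eq_sym q); case: (p == q); rewrite ?mulr1 ?mulr0.
rewrite mulmx_sumr mulmx_suml; apply: eq_bigr => m _.
by rewrite -scalemxAr -scalemxAl.
Qed.

End ConjIdempotents.

Lemma idem2_comm (F : numFieldType) (n : nat) (i j k : 'I_n) (a c : F) :
  i != j -> i != k -> j != k ->
  idem2 i j k a c *m delta_mx i k = delta_mx i k *m idem2 i j k a c.
Proof.
move=> ij ik jk; rewrite /idem2 !(mulmxDl, mulmxDr, mulNmx, mulmxN).
rewrite -!scalemxAl -!scalemxAr !mul_delta_mx_cond.
rewrite !(eq_sym _ i) !(eq_sym k j) (negPf ij) (negPf ik) (negPf jk).
by rewrite !mulr0n !scaler0.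
Qed.

(** As [e] tends to [0], multiples of idempotents approach combinations of matrix units in row [i].
    Through [line_limit], this transfers knowledge of [phi] from idempotents to nilpotents. *)
Lemma scale_idem1 (F : numFieldType) (n : nat) (i j k : 'I_n) (e x y : F) : e != 0 ->
  e *: idem1 i j k (e^-1 * x) (e^-1 * y) =
  x *: delta_mx i j + y *: delta_mx i k + e *: delta_mx i i.
Proof.
move=> e0; apply/matrixP => p q; rewrite /idem1 !mxE.
by field.
Qed.

Lemma scale_idem2 (F : numFieldType) (n : nat) (i j k : 'I_n) (e x t : F) : e != 0 ->
  e *: idem2 i j k t (e^-1 * x) =
  x *: (delta_mx j k - t *: delta_mx i k) + e *: (delta_mx j j - t *: delta_mx i j).
Proof.
move=> e0; apply/matrixP => p q; rewrite /idem2 !mxE.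
by field.
Qed.

Section Chain.
Variables (R : realType) (n : nat) (rho : rel 'I_n).
Hypothesis rho_qo : quasi_order rho.
Variable phi : 'M[R[i]]_n -> 'M[R[i]]_n.
Hypothesis phi_adm : admissible (SMA R rho) phi.

(** All diagonal matrices conjugated by one [V] are handled by a single [T], so families of
    orthogonal idempotents of trace one are sent to such families. *)
Lemma admissible_conj_diag (V V' : 'M[R[i]]_n) :
  SMA R rho V -> SMA R rho V' -> V *m V' = 1%:M ->
  exists T T' : 'M[R[i]]_n, T *m T' = 1%:M /\
    forall d, phi (V *m diag_mx d *m V') = T *m diag_mx d *m T'.
Proof.
move=> AV AV' VV'.
have [T [T' [TT' TE]]] := admissible_diag rho_qo
  (admissible_conj rho_qo AV AV' VV' (mulmx1 1%:M) phi_adm).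
exists T, T'; split=> // d; rewrite -TE.
exact: esym (etrans (mulmx1 _) (mul1mx _)).
Qed.

Hypothesis phi_diag : forall d, phi (diag_mx d) = diag_mx d.

Lemma phi_delta (m : 'I_n) : phi (delta_mx m m) = delta_mx m m.
Proof. by rewrite -diag_delta phi_diag. Qed.

Variables (i j k : 'I_n) (c13 : R[i]).
Hypotheses (ij : i != j) (ik : i != k) (jk : j != k) (rij : rho i j) (rjk : rho j k).
Hypotheses (c13_neq0 : c13 != 0) (phi_ik : phi (delta_mx i k) = c13 *: delta_mx i k).
Local Notation E := delta_mx.
Local Notation hV := (heisV i j k).
Local Notation h := (heis i j k).

Let rik : rho i k. Proof. exact: (proj2 rho_qo) rij rjk. Qed.

Lemma SMA_heis a b c : SMA R rho (h a b c).
Proof.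
by rewrite /heis; do 3!(apply: SMA_line; last exact: SMA_delta); exact: SMA_scalar.
Qed.

Let heisP a b c : exists T T' : 'M[R[i]]_n, T *m T' = 1%:M /\
    forall d, phi (hV a b c *m diag_mx d *m h a b c) = T *m diag_mx d *m T'.
Proof.
apply: admissible_conj_diag; [exact: SMA_heis|exact: SMA_heis|].
exact: heisVK.
Qed.

Let tr_heis a b c p : \tr (phi (hV a b c *m E p p *m h a b c)) = 1.
Proof.
have [T [T' [TT' TE]]] := heisP a b c.
by have := TE (E 0 p); rewrite diag_delta => ->; exact: conj_delta_trace.
Qed.

Let mul_heis a b c p q :
  phi (hV a b c *m E p p *m h a b c) *m phi (hV a b c *m E q q *m h a b c) =
  (p == q)%:R *: phi (hV a b c *m E p p *m h a b c).
Proof.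
have [T [T' [TT' TE]]] := heisP a b c.
have {}TE r : phi (hV a b c *m E r r *m h a b c) = T *m E r r *m T'.
  by have := TE (E 0 r); rewrite diag_delta.
rewrite (TE p) (TE q); exact: (conj_delta_mul TT').
Qed.

Let mul0_heis a b c p q : p != q ->
  phi (hV a b c *m E p p *m h a b c) *m phi (hV a b c *m E q q *m h a b c) = 0.
Proof. by move=> pq; rewrite mul_heis (negPf pq) scale0r. Qed.

Let P1E (a b c : R[i]) := heis_idem1 ij ik jk a b c.
Let P2E (a b c : R[i]) := heis_idem2 ij ik jk a b c.
Let P3E (a b c : R[i]) := heis_idem3 ij ik jk a b c.

(** The hypotheses of [heis_idempotents] are transported by [phi]: trace and orthogonality through
    [heisP], commutation with [E i k] because [phi] only rescales it, and the two inequalities by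
    injectivity. *)
Lemma chain_idempotents : exists al ga g : R[i] -> R[i],
    [/\ forall a b, phi (idem1 i j k a b) = idem1 i j k (al a) (g b),
        forall a c, phi (idem2 i j k a c) = idem2 i j k (al a) (ga c),
        forall b c, phi (idem3 i j k b c) = idem3 i j k (g b) (ga c),
        forall a c, g (a * c) = al a * ga c &
        {morph g : x y / x + y}].
Proof.
have ji : j != i by rewrite eq_sym.
have ki : k != i by rewrite eq_sym.
have kj : k != j by rewrite eq_sym.
have P3E' (b c : R[i]) : hV 0 b c *m E k k *m h 0 b c = idem3 i j k b c.
  by rewrite P3E mul0r subr0.
have SMA2 (a c : R[i]) : SMA R rho (idem2 i j k a c).
  by rewrite -(P2E a 0 c); do !apply: SMA_mul => //;
    [exact: SMA_heis|exact: SMA_delta (proj1 rho_qo j)|exact: SMA_heis].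
have P2inj (a c : R[i]) : idem2 i j k a c != idem2 i j k 0 0 ->
    phi (idem2 i j k a c) != phi (idem2 i j k 0 0).
  move=> ne; apply/eqP => e; case/eqP: ne.
  exact: adm_inj phi_adm _ _ (mem_set (SMA2 a c)) (mem_set (SMA2 0 0)) e.
have P200 : idem2 i j k 0 0 = E j j :> 'M[R[i]]_n.
  by rewrite /idem2 mul0r !scale0r !subr0 addr0.
apply: (heis_idempotents ij ik jk
  (Z1 := fun a b => phi (idem1 i j k a b)) (Z2 := fun a b => phi (idem2 i j k a b))
  (Z3 := fun a b => phi (idem3 i j k a b))).
- by move=> a b; rewrite -(P1E a b 0).
- by move=> a c; rewrite -(P2E a 0 c).
- by move=> b c; rewrite -P3E'.
- by move=> a c; rewrite -(P2E a 0 c) mul_heis eqxx scale1r.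
- by move=> a b c; rewrite -(P2E a b c) -(P1E a b c); split; exact: mul0_heis.
- by move=> a b c; rewrite -(P3E a b c) -(P1E a b c); split; exact: mul0_heis.
- by move=> a b c; rewrite -(P2E a b c) -(P3E a b c); split; exact: mul0_heis.
- move=> m mi mj mk a b.
  (* [E m m] is invariant under Heisenberg conjugation, so it joins the orthogonal family of each
     idempotent. *)
  have mE (a' b' c' : R[i]) : E m m = phi (hV a' b' c' *m E m m *m h a' b' c').
    by rewrite heis_other // phi_delta.
  split.
  + by rewrite (mE a b 0) -(P1E a b 0); apply: mul0_heis; rewrite eq_sym.
  + by rewrite (mE a b 0) -(P1E a b 0); apply: mul0_heis.
  + by rewrite (mE a 0 b) -(P2E a 0 b); apply: mul0_heis; rewrite eq_sym.
  + by rewrite (mE a 0 b) -(P2E a 0 b); apply: mul0_heis.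
  by split; rewrite (mE 0 a b) -P3E'; apply: mul0_heis; rewrite // eq_sym.
- by rewrite /idem1 !scale0r !addr0 phi_delta.
- by rewrite P200 phi_delta.
- by rewrite /idem3 !scale0r !subr0 phi_delta.
- move=> a c; have := idem2_comm a c ij ik jk.
  move/(adm_comm phi_adm (SMA2 a c) (SMA_delta _ rik)).
  by rewrite phi_ik -scalemxAl -scalemxAr => /(scalerI c13_neq0).
- apply: P2inj; rewrite P200; apply/eqP => /matrixP/(_ i j)/eqP.
  rewrite /idem2 mulr0 !scale0r !mxE !eqxx ?(negPf ij) ?(negPf jk) /=.
  by rewrite !(mulr0, mulr1, addr0, subr0) sub0r oppr_eq0 oner_eq0.
- apply: P2inj; rewrite P200; apply/eqP => /matrixP/(_ j k)/eqP.
  rewrite /idem2 mul0r !scale0r !mxE !eqxx ?(negPf kj) ?(negPf ji) /=.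
  by rewrite !(mulr0, mulr1, addr0, subr0) add0r oner_eq0.
Qed.

(** A limit argument upgrades the additive [g] to multiplication by [c13]; then
    [g (a * c) = al a * ga c] makes [al] and [ga] linear, with slopes of product [c13]. The last two
    formulas are limits of multiples of idempotents. *)
Lemma chain_heis : exists c12 c23 : R[i],
  [/\ c12 * c23 = c13,
   forall a b c d, phi (hV a b c *m diag_mx d *m h a b c) =
     hV (c12 * a) (c13 * b) (c23 * c) *m diag_mx d *m h (c12 * a) (c13 * b) (c23 * c),
   forall x y, phi (x *: E i j + y *: E i k) = (c12 * x) *: E i j + (c13 * y) *: E i k &
   forall x t, phi (x *: (E j k - t *: E i k)) = (c23 * x) *: (E j k - (c12 * t) *: E i k)].
Proof.
have [al [ga [g [phi1 phi2 phi3 gM gD]]]] := chain_idempotents.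
have scale_phi (a b c : R[i]) p x : phi (x *: (hV a b c *m E p p *m h a b c)) =
    x *: phi (hV a b c *m E p p *m h a b c).
  have [T [T' [_ TE]]] := heisP a b c.
  have := TE (x *: E 0 p); have := TE (E 0 p).
  have -> : diag_mx (x *: E 0 p) = x *: E p p :> 'M[R[i]]_n.
    by rewrite scaled_delta.
  rewrite diag_delta => E1; rewrite !conj_scale => E2.
  exact: etrans E2 (congr1 _ (esym E1)).
have al0 : al 0 = 0.
  have /matrixP/(_ i j) := phi1 0 0.
  rewrite {1}/idem1 !scale0r !addr0 phi_delta !mxE !eqxx (eq_sym j) (negPf ij) (negPf jk) /=.
  by rewrite mulr1 mulr0 add0r addr0.
have g_nat m b : g (m%:R * b) = m%:R * g b.
  elim: m => [|m IH].
    by have /eqP := gD 0 0; rewrite addr0 -subr_eq subrr => /eqP g0; rewrite mulr0n !mul0r.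
  by rewrite mulrSr !mulrDl gD IH !mul1r.
have g_lin b : g b = c13 * b.
  have [->|b0] := eqVneq b 0; first by have := g_nat 0 0; rewrite !mul0r mulr0.
  (* [E i k] is approached by [f] times [idem1 i j k 0 f^-1] with [f = e / b]. As [e^-1] is a
     natural number, additivity alone evaluates [g] at [f^-1], and the coefficient of [E i k] is
     [g b / b] throughout. *)
  have : phi (E i k) = (g b / b) *: E i k.
    apply: (line_limit (D := SMA R rho) (Y := b^-1 *: E i i) (M := b^-1 *: E i i)).
    - exact: adm_line phi_adm.
    - exact: SMA_delta.
    - by apply: SMA_scale; apply: SMA_delta; exact: (proj1 rho_qo).
    move=> N; exists N => //; set e := _^-1.
    have e0 : e != 0 by rewrite invr_eq0 pnatr_eq0.
    pose f := e * b^-1; have f0 : f != 0 by rewrite mulf_neq0 // invr_eq0.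
    have fV : f^-1 = N.+1%:R * b by rewrite /f invfM !invrK mulrC.
    have XE (x : R[i]) : x *: E i k + e *: (b^-1 *: E i i) = f *: idem1 i j k 0 (f^-1 * x).
      by have := scale_idem1 i j k 0 x f0; rewrite mulr0 scale0r add0r scalerA.
    rewrite -[E i k in LHS]scale1r !XE -(P1E 0 (f^-1 * 1) 0) scale_phi P1E phi1 al0.
    by rewrite mulr1 fV g_nat -mulrA [b * _]mulrC (divfK b0).
  rewrite phi_ik => /matrixP/(_ i k); rewrite !mxE !eqxx !mulr1 => ->.
  by rewrite mulfVK.
have gM1 a c : c13 * (a * c) = al a * ga c by rewrite -gM g_lin.
have alga1 : al 1 * ga 1 = c13 by rewrite -gM1 !mulr1.
have al1 : al 1 != 0 by apply: contraNneq c13_neq0 => a0; rewrite -alga1 a0 mul0r.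
have ga1 : ga 1 != 0 by apply: contraNneq c13_neq0 => a0; rewrite -alga1 a0 mulr0.
have alE a : al a = al 1 * a.
  by apply: (mulIf ga1); rewrite -gM1 -alga1; ring.
have gaE c : ga c = ga 1 * c.
  by apply: (mulfI al1); rewrite -gM1 -alga1; ring.
exists (al 1), (ga 1); split; first exact: alga1.
- move=> a b c d; have [T [T' [_ TE]]] := heisP a b c.
  rewrite TE !conj_diag_sum; apply: eq_bigr => m _; congr (_ *: _).
  have <- : phi (hV a b c *m E m m *m h a b c) = T *m E m m *m T'.
    by have := TE (E 0 m); rewrite diag_delta.
  have [->|mi] := eqVneq m i.
    apply: (etrans _ (esym (heis_idem1 ij ik jk _ _ _))).
    by rewrite (P1E a b c) phi1 alE g_lin.
  have [->|mj] := eqVneq m j.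
    apply: (etrans _ (esym (heis_idem2 ij ik jk _ _ _))).
    by rewrite (P2E a b c) phi2 alE gaE.
  have [->|mk] := eqVneq m k; last first.
    apply: (etrans _ (esym (heis_other _ _ _ mi mj mk))).
    by rewrite (heis_other a b c mi mj mk) phi_delta.
  apply: (etrans _ (esym (heis_idem3 ij ik jk _ _ _))).
  rewrite (P3E a b c) phi3 gaE g_lin; congr idem3.
  by rewrite -alga1; ring.
- move=> x y.
  apply: (line_limit (D := SMA R rho) (Y := E i i) (M := E i i)).
  + exact: adm_line phi_adm.
  + by apply: SMA_line; [apply: SMA_scale|]; exact: SMA_delta.
  + by apply: SMA_delta; exact: (proj1 rho_qo).
  move=> N; exists N => //; set e := _^-1.
  have e0 : e != 0 by rewrite invr_eq0 pnatr_eq0.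
  rewrite -!(scale_idem1 i j k _ _ e0) -(P1E _ _ 0) scale_phi P1E phi1 alE g_lin.
  by rewrite !(mulrCA e^-1).
move=> x t.
apply: (line_limit (D := SMA R rho) (Y := E j j - t *: E i j)
  (M := E j j - (al 1 * t) *: E i j)).
- exact: adm_line phi_adm.
- by rewrite -scaleNr; apply: SMA_scale; apply: SMA_line; exact: SMA_delta.
- by rewrite -scaleNr; apply: SMA_line; apply: SMA_delta => //; exact: (proj1 rho_qo).
move=> N; exists N => //; set e := _^-1.
have e0 : e != 0 by rewrite invr_eq0 pnatr_eq0.
rewrite -!(scale_idem2 i j k _ _ e0) -(P2E _ 0 _) scale_phi P2E phi2 alE gaE.
by rewrite !(mulrCA e^-1).
Qed.

Lemma chain_units : exists c12 c23 : R[i],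
  [/\ c12 * c23 = c13,
   forall x, phi (x *: E i j) = (c12 * x) *: E i j,
   forall x, phi (x *: E j k) = (c23 * x) *: E j k &
   forall x, phi (x *: E i k) = (c13 * x) *: E i k].
Proof.
have [c12 [c23 [c1 _ rowE colE]]] := chain_heis; exists c12, c23; split=> // x.
- by have := rowE x 0; rewrite mulr0 !scale0r !addr0.
- by have := colE x 0; rewrite mulr0 !scale0r !subr0.
- by have := rowE 0 x; rewrite mulr0 !scale0r !add0r.
Qed.

End Chain.

(** * Maps fixing every matrix unit *)

Lemma scale_delta_inj (F : fieldType) (n : nat) (p q : 'I_n) (x y : F) :
  x *: delta_mx p q = y *: delta_mx p q :> 'M[F]_n -> x = y.
Proof. by move/matrixP/(_ p q); rewrite !mxE !eqxx !mulr1. Qed.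

(** Condition (i) without cardinals: for [rho i j], the indices [i] and [j] are themselves in the
    intersection, so three elements mean one more. *)
Definition has_third (n : nat) (rho : rel 'I_n) : Prop :=
  forall i j, rho i j -> i != j -> exists m,
    [/\ m != i, m != j, rho m i || rho i m & rho m j || rho j m].

(** The new index precedes [i], follows [j], or else lies between them; each time the three form a
    chain containing the step from [i] to [j]. *)
Lemma third_chain (n : nat) (rho : rel 'I_n) (i j : 'I_n) :
  has_third rho -> rho i j -> i != j -> exists m,
    [/\ m != i, m != j & [|| rho m i, rho j m | rho i m && rho m j]].
Proof.
move=> third rij ij; have [m [mi mj]] := third i j rij ij.
move=> rmi rmj; exists m; split=> //; move: rmi rmj.
by case: (rho m i); case: (rho i m); case: (rho m j); case: (rho j m).
Qed.

Definition transv (F : fieldType) (n : nat) (i j : 'I_n) (t : F) : 'M[F]_n :=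
  1%:M + t *: delta_mx i j.

Lemma transvK (F : fieldType) (n : nat) (i j : 'I_n) (t : F) : i != j ->
  transv i j t *m transv i j (- t) = 1%:M.
Proof.
move=> ij; rewrite /transv mulmxDl !mulmxDr !mul1mx mulmx1 -scalemxAl -scalemxAr.
by rewrite mul_delta_mx_0 1?eq_sym // !scaler0 addr0 scaleNr subrK.
Qed.

Lemma transv_conj (F : fieldType) (n : nat) (i j : 'I_n) (t : F) (X : 'M[F]_n) :
  transv i j t *m X *m transv i j (- t) =
  X + t *: (delta_mx i j *m X) - t *: (X *m delta_mx i j)
    - (t * t) *: (delta_mx i j *m X *m delta_mx i j).
Proof.
rewrite /transv !(mulmxDl, mulmxDr) !mul1mx !mulmx1 -!scalemxAl -!scalemxAr -?scalemxAl.
by apply/matrixP => p q; rewrite !mx_entryE; ring.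
Qed.

(** The normal form reached after all normalizations; [fixes_units_id] shows that such a map is the
    identity on the algebra. *)
Record fixes_units (R : realType) (n : nat) (rho : rel 'I_n)
    (phi : 'M[R[i]]_n -> 'M[R[i]]_n) : Prop := FixesUnits {
  fix_adm : admissible (SMA R rho) phi;
  fix_diag : forall d, phi (diag_mx d) = diag_mx d;
  fix_unit : forall p q, rho p q -> phi (delta_mx p q) = delta_mx p q }.

Section FixedChain.
Variables (R : realType) (n : nat) (rho : rel 'I_n).
Hypothesis rho_qo : quasi_order rho.
Variable phi : 'M[R[i]]_n -> 'M[R[i]]_n.
Hypothesis phi_fix : fixes_units rho phi.
Variables i j k : 'I_n.
Hypotheses (ij : i != j) (ik : i != k) (jk : j != k) (rij : rho i j) (rjk : rho j k).
Local Notation E := delta_mx.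

(** The constants of [chain_heis] are read off the matrix units, which are fixed, so they are all
    [1]. *)
Lemma fixed_chain :
  [/\ forall a b c d, phi (heisV i j k a b c *m diag_mx d *m heis i j k a b c) =
       heisV i j k a b c *m diag_mx d *m heis i j k a b c,
   forall t : R[i], phi (E i j + t *: E i k) = E i j + t *: E i k &
   forall t : R[i], phi (E j k - t *: E i k) = E j k - t *: E i k].
Proof.
have rik : rho i k by exact: (proj2 rho_qo) rij rjk.
have unitE p q : rho p q -> phi (E p q) = 1 *: E p q.
  by rewrite scale1r; exact: fix_unit phi_fix _ _.
have [c12 [c23 [_ heisE rowE colE]]] := chain_heis rho_qo (fix_adm phi_fix)
  (fix_diag phi_fix) ij ik jk rij rjk (oner_neq0 _) (unitE _ _ rik).
have c12E : c12 = 1.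
  apply: (@scale_delta_inj _ _ i j); rewrite -(unitE _ _ rij).
  by have := rowE 1 0; rewrite !mulr1 mulr0 !scale0r !addr0 scale1r.
have c23E : c23 = 1.
  apply: (@scale_delta_inj _ _ j k); rewrite -(unitE _ _ rjk).
  by have := colE 1 0; rewrite !mulr1 mulr0 !scale0r !subr0 scale1r.
rewrite c12E c23E in heisE rowE colE; split=> [a b c d|t|t].
- by have := heisE a b c d; rewrite !mul1r.
- by have := rowE 1 t; rewrite !mul1r scale1r.
- by have := colE 1 t; rewrite !mul1r scale1r.
Qed.

End FixedChain.

(** The conjugates by the transvection of diagonal matrices, and of all units but [E j i], are among
    the matrices fixed by [fixed_chain]. For [E j i] the multiplicativity of the constants in
    [chain_units] decides. *)
Lemma fixes_units_transv (R : realType) (n : nat) (rho : rel 'I_n)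
    (phi : 'M[R[i]]_n -> 'M[R[i]]_n) (i j : 'I_n) (t : R[i]) :
  quasi_order rho -> has_third rho -> fixes_units rho phi -> rho i j -> i != j ->
  fixes_units rho (fun X => transv i j (- t) *m
    phi (transv i j t *m X *m transv i j (- t)) *m transv i j t).
Proof.
move=> rho_qo third phi_fix rij ij.
have A_transv x : SMA R rho (transv i j x).
  by apply: SMA_line; [exact: SMA_scalar|exact: SMA_delta].
have VV' := transvK t ij.
set psi := fun X => _.
have psi_adm : admissible (SMA R rho) psi.
  have H := admissible_conj rho_qo (A_transv _) (A_transv _) VV' VV' (fix_adm phi_fix); exact: H.
have psi_fix X : phi (transv i j t *m X *m transv i j (- t)) =
    transv i j t *m X *m transv i j (- t) -> psi X = X.
  by move=> E; rewrite /psi E; exact: conj_cancel (mulmx1C VV').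
have psi_diag d : psi (diag_mx d) = diag_mx d.
  apply: psi_fix.
  (* The transvection is a Heisenberg element with one nonzero parameter: [c], [a] or [b] according
     as [m] precedes, follows or lies between [i] and [j]. *)
  have [m [mi mj]] := third_chain third rij ij.
  have im : i != m by rewrite eq_sym.
  have jm : j != m by rewrite eq_sym.
  case/or3P=> [rmi|rjm|/andP[rim rmj]].
  - have [/(_ 0 0 (- t) d) + _ _] := fixed_chain rho_qo phi_fix mi mj ij rmi rij.
    by rewrite /heisV /heis !(mul0r, oppr0, subr0, opprK, scale0r, addr0).
  - have [/(_ (- t) 0 0 d) + _ _] := fixed_chain rho_qo phi_fix ij im jm rij rjm.
    by rewrite /heisV /heis !(mulr0, oppr0, subr0, opprK, scale0r, addr0).
  have [/(_ 0 (- t) 0 d) + _ _] := fixed_chain rho_qo phi_fix im ij mj rim rmj.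
  by rewrite /heisV /heis !(mulr0, oppr0, subr0, sub0r, opprK, scale0r, addr0).
split=> //.
(* Conjugation adds at most one further unit: in the same column when [p = j], in the same row when
   [q = i]. *)
have psi_unit p q : rho p q -> p != q -> ~~ ((p == j) && (q == i)) ->
    psi (delta_mx p q) = delta_mx p q.
  move=> rpq pq pqji; apply: psi_fix.
  have phi_unit := fix_unit phi_fix.
  rewrite transv_conj !mul_delta_mx_cond (eq_sym j) /=.
  move: pqji; have [pj /= qi|pj] := eqVneq p j.
    rewrite (negPf qi) !mulr1n !mulr0n scaler0 subr0.
    rewrite mul_delta_mx_cond (negPf qi) mulr0n scaler0 subr0.
    have rjq : rho j q by rewrite -pj.
    have jq : j != q by rewrite -pj.
    have iq : i != q by rewrite eq_sym.
    have [_ _ /(_ (- t))] := fixed_chain rho_qo phi_fix ij iq jq rij rjq.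
    by rewrite scaleNr opprK pj.
  rewrite !mulr0n scaler0 addr0 mul0mx scaler0 subr0.
  have [qi|qi] := eqVneq q i; last by rewrite mulr0n scaler0 subr0 phi_unit.
  rewrite mulr1n -scaleNr qi => _.
  have rpi : rho p i by rewrite -qi.
  have pi : p != i by rewrite -qi.
  have [_ + _] := fixed_chain rho_qo phi_fix pi pj ij rpi rij; exact.
move=> p q rpq.
have [->|pq] := eqVneq p q; first by rewrite -diag_delta psi_diag.
have [/andP[/eqP pj /eqP qi]|] := boolP ((p == j) && (q == i)); last exact: psi_unit.
rewrite {}pj {}qi {pq} in rpq *.
have ji : j != i by rewrite eq_sym.
(* Now [i] and [j] are equivalent, so [m] may be taken before both or after both. In the chain [m],
   [j], [i] or [j], [i], [m], two constants are [1] by [psi_unit], hence the third is too. *)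
have [m [mi mj]] := third_chain third rij ij.
have [rmi|_] := boolP (rho m i).
  have rmj : rho m j by exact: (proj2 rho_qo) rmi rij.
  have psi_mi : psi (delta_mx m i) = 1 *: delta_mx m i.
    by rewrite scale1r psi_unit // (negPf mj).
  have [c12 [c23 [c1 psi_mj psi_ji _]]] :=
    chain_units rho_qo psi_adm psi_diag mj mi ji rmj rpq (oner_neq0 _) psi_mi.
  have c12E : c12 = 1.
    apply: (@scale_delta_inj _ _ m j).
    by have := psi_mj 1; rewrite mulr1 !scale1r => <-; rewrite psi_unit // (negPf mj).
  have := psi_ji 1; rewrite mulr1 scale1r => ->.
  by rewrite -[c23]mul1r -c12E c1 scale1r.
move=> /= rjm.
have {}rjm : rho j m by case/orP: rjm => // /andP[rim _]; exact: (proj2 rho_qo) rpq rim.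
have rim : rho i m by exact: (proj2 rho_qo) rij rjm.
have im : i != m by rewrite eq_sym.
have jm : j != m by rewrite eq_sym.
have psi_jm : psi (delta_mx j m) = 1 *: delta_mx j m.
  by rewrite scale1r psi_unit // (negPf mi) andbF.
have [c12 [c23 [c1 psi_ji psi_im _]]] :=
  chain_units rho_qo psi_adm psi_diag ji jm im rpq rim (oner_neq0 _) psi_jm.
have c23E : c23 = 1.
  apply: (@scale_delta_inj _ _ i m).
  by have := psi_im 1; rewrite mulr1 !scale1r => <-; rewrite psi_unit // (negPf mi) andbF.
have := psi_ji 1; rewrite mulr1 scale1r => ->.
by rewrite -[c12]mulr1 -c23E c1 scale1r.
Qed.

(** * Reduction of matrices by conjugation inside the algebra *)

Lemma annihilating_roots (F : closedFieldType) (n : nat) (X : 'M[F]_n) :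
  exists rs : seq F, forall v : 'cV[F]_n,
    foldr (fun r w => X *m w - r *: w) v rs = 0.
Proof.
case: n X => [|n] X; first by exists [::] => v; rewrite /= [v]flatmx0.
have [rs rsE] := closed_field_poly_normal (char_poly X).
have := char_poly_monic X; rewrite monicE => /eqP lc.
rewrite lc scale1r in rsE; exists rs => v.
have -> : foldr (fun r w => X *m w - r *: w) v rs =
          horner_mx X (\prod_(z <- rs) ('X - z%:P)) *m v.
  elim: rs {rsE} => [|r rs IH] /=; first by rewrite big_nil rmorph1 mul1mx.
  rewrite IH big_cons rmorphM /= rmorphB /= horner_mx_X horner_mx_C.
  by rewrite -mulmxE -mulmxA mulmxBl mul_scalar_mx.
by rewrite -rsE Cayley_Hamilton mul0mx.
Qed.

(** By Cayley-Hamilton, successive factors [X - r] end up killing [v]; the last nonzero vector on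
    the way is an eigenvector, and it has kept the property [P]. *)
Lemma stable_eigenvector (F : closedFieldType) (n : nat) (X : 'M[F]_n)
    (P : 'cV[F]_n -> Prop) (v : 'cV[F]_n) :
  (forall w r, P w -> P (X *m w - r *: w)) -> P v -> v != 0 ->
  exists r w, [/\ P w, w != 0 & X *m w = r *: w].
Proof.
move=> P_stable Pv v0; have [rs /(_ v)] := annihilating_roots X.
set f := fun r w => _.
elim: rs => [/= v_eq0|r rs IH /= fw0]; first by rewrite v_eq0 eqxx in v0.
have Pw : P (foldr f v rs).
  by elim: rs {IH fw0} => [//|s rs IH] /=; exact: P_stable.
have [/IH//|w0] := eqVneq (foldr f v rs) 0.
by exists r, (foldr f v rs); split=> //; apply/eqP; rewrite -subr_eq0; apply/eqP.
Qed.

(** By Cayley-Hamilton the inverse is a polynomial in [G], the constant term of the characteristic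
    polynomial being nonzero. *)
Lemma SMA_inv (R : realType) (n : nat) (rho : rel 'I_n) (G : 'M[R[i]]_n) :
  quasi_order rho -> SMA R rho G -> G \in unitmx -> SMA R rho (invmx G).
Proof.
case: n rho G => [|n] rho G rho_qo AG Gunit; first by move=> [].
set p := char_poly G.
have p0 : p.[0] != 0.
  apply/negP => rp; have : eigenvalue G 0 by rewrite eigenvalue_root_char.
  case/eigenvalueP => v; rewrite scale0r => vG /negP[]; apply/eqP.
  by rewrite -[v]mulmx1 -(mulmxV Gunit) mulmxA vG mul0mx.
have /factor_theorem[q qE] : root (p - p.[0]%:P) 0 by rewrite /root !hornerE subrr.
have A_horner (s : {poly R[i]}) : SMA R rho (horner_mx G s).
  elim/poly_ind: s => [|s c IH]; first by rewrite rmorph0 => i j _; rewrite mxE.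
  rewrite rmorphD rmorphM /= horner_mx_X horner_mx_C -mulmxE.
  by apply: SMA_add; [exact: SMA_mul|exact: SMA_scalar].
have GE : horner_mx G q *m G = (- p.[0])%:M.
  have := congr1 (horner_mx G) qE; rewrite rmorphM !rmorphB /= !horner_mx_C horner_mx_X.
  by rewrite Cayley_Hamilton sub0r raddf0 subr0 -mulmxE => <-; rewrite raddfN.
have -> : invmx G = - p.[0]^-1 *: horner_mx G q.
  rewrite -[horner_mx G q]mulmx1 -(mulmxV Gunit) mulmxA GE mul_scalar_mx scalerA.
  by rewrite mulrNN mulVf // scale1r.
exact: SMA_scale.
Qed.

(** Its algebra consists of the matrices of the original one that are diagonal outside the block on
    [S]; the size of [S] is the induction measure of [fixes_units_id]. *)
Definition restrict_rel (n : nat) (rho : rel 'I_n) (S : {set 'I_n}) : rel 'I_n :=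
  fun p q => (p == q) || [&& rho p q, p \in S & q \in S].

Lemma restrict_rel_qo (n : nat) (rho : rel 'I_n) (S : {set 'I_n}) :
  quasi_order rho -> quasi_order (restrict_rel rho S).
Proof.
move=> [rho_refl rho_trans]; split=> [p|q p r]; first by rewrite /restrict_rel eqxx.
rewrite /restrict_rel; have [->//|_] := eqVneq p q; have [<-|_] := eqVneq q r.
  by move=> /= -> _; rewrite orbT.
move=> /= /and3P[pq Sp _] /and3P[qr _ Sr]; by rewrite Sp Sr (rho_trans _ _ _ pq qr) orbT.
Qed.

Lemma conj_nest (F : fieldType) (n : nat) (P Q X Y Z : 'M[F]_n) :
  P *m Q *m X *m (Y *m Z) = P *m (Q *m X *m Y) *m Z.
Proof. by rewrite !mulmxA. Qed.

Section FixedPoints.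
Variables (R : realType) (n : nat) (rho : rel 'I_n).
Hypotheses (rho_qo : quasi_order rho) (third : has_third rho).
Local Notation E := delta_mx.
Implicit Types X N : 'M[R[i]]_n.

(** The quantification over all [phi] is essential: conjugating by a transvection replaces [phi] by
    another map of the class. *)
Definition fixed_point X : Prop :=
  forall phi, fixes_units rho phi -> phi X = X.

Lemma fixed_point_transv (i j : 'I_n) (t : R[i]) X : rho i j -> i != j ->
  fixed_point (transv i j (- t) *m X *m transv i j t) -> fixed_point X.
Proof.
move=> rij ij fX phi phi_fix.
have := fX _ (fixes_units_transv t rho_qo third phi_fix rij ij).
have VV' := transvK t ij.
move/(congr1 (fun M => transv i j t *m M *m transv i j (- t))).
rewrite [LHS](conj_cancel _ VV') [RHS](conj_cancel _ VV').
by rewrite (conj_cancel X VV').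
Qed.

(** The units occurring in [N] lead from outside [S] into [S], so their products vanish. Thus
    [1 + N] is a product of transvections, one per entry, with inverse [1 - N]. *)
Lemma fixed_point_unip (S : {set 'I_n}) N X : SMA R rho N ->
  (forall p q, N p q != 0 -> p \notin S /\ q \in S) ->
  fixed_point ((1%:M - N) *m X *m (1%:M + N)) -> fixed_point X.
Proof.
move=> AN N_S.
pose Ns (s : seq ('I_n * 'I_n)) := \sum_(x <- s) N x.1 x.2 *: E x.1 x.2.
have NsE : N = Ns (index_enum _).
  by rewrite [LHS]matrix_sum_delta pair_bigA.
rewrite {1 2}NsE; move: (index_enum _) => s {NsE}.
elim: s X => [|[p q] s IH] X.
  by rewrite /Ns big_nil subr0 addr0 mulmx1 mul1mx.
have [N0|Npq] := eqVneq (N p q) 0.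
  by rewrite /Ns big_cons /= N0 scale0r add0r; exact: IH.
have [pS qS] := N_S _ _ Npq.
have rpq : rho p q by apply: contraNT Npq => /AN ->.
have pq : p != q by apply: contraNneq pS => ->.
have Nsp : Ns s *m E p q = 0.
  rewrite /Ns mulmx_suml big1 // => -[u w] _ /=; rewrite -scalemxAl mul_delta_mx_cond.
  have [wp|_] := eqVneq w p; last by rewrite mulr0n scaler0.
  have [->|/N_S[_]] := eqVneq (N u w) 0; first by rewrite scale0r.
  by rewrite wp (negPf pS).
have Nsq : E p q *m Ns s = 0.
  rewrite /Ns mulmx_sumr big1 // => -[u w] _ /=; rewrite -scalemxAr mul_delta_mx_cond.
  have [qu|_] := eqVneq q u; last by rewrite mulr0n scaler0.
  have [->|/N_S[]] := eqVneq (N u w) 0; first by rewrite scale0r.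
  by rewrite -qu qS.
have -> : 1%:M + Ns ((p, q) :: s) = transv p q (N p q) *m (1%:M + Ns s).
  rewrite /Ns big_cons /= -/(Ns s) /transv mulmxDl mul1mx mulmxDr mulmx1 -scalemxAl Nsq.
  by rewrite scaler0 addr0 addrA addrAC.
have -> : 1%:M - Ns ((p, q) :: s) = (1%:M - Ns s) *m transv p q (- N p q).
  rewrite /Ns big_cons /= -/(Ns s) /transv mulmxBl mul1mx mulmxDr mulmx1 -scalemxAr Nsp.
  by rewrite scaler0 addr0 scaleNr opprD addrA.
by rewrite conj_nest => /IH; exact: fixed_point_transv.
Qed.

Lemma restrict_SMA (S : {set 'I_n}) X : SMA R (restrict_rel rho S) X -> SMA R rho X.
Proof.
move=> AX p q; have [->|pq] := eqVneq p q; first by rewrite (proj1 rho_qo).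
by move=> rpq; apply: AX; rewrite /restrict_rel (negPf pq) (negPf rpq).
Qed.

(** An index with the fewest predecessors in [S] works: a predecessor that is not also a successor
    would have strictly fewer, [i] being lost. *)
Lemma minimal_class (S : {set 'I_n}) : (exists i, i \in S) -> exists2 i, i \in S &
  forall p, p \in S -> rho p i -> rho i p.
Proof.
case=> i0 i0S.
have [i iS imin] := @arg_minnP _ i0 [in S] (fun p => #|[set q in S | rho q p]%SET|) i0S.
exists i => // p pS rpi; apply/negPn/negP => nip.
have := imin p pS; rewrite leqNgt => /negP; apply; apply/proper_card/properP; split.
  apply/fintype.subsetP => q; rewrite !inE => /andP[-> qp]; exact: (proj2 rho_qo) qp rpi.
by exists i; rewrite !inE iS ?(proj1 rho_qo) ?(negPf nip).
Qed.

(** Vectors supported on the predecessors of a minimal [i0] in [S] are stable under [X], so one of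
    them, [v], is an eigenvector. Conjugation moves it to a basis vector; by minimality every index
    of its support precedes [i], so the conjugating matrix is in the algebra. *)
Lemma clear_column (S : {set 'I_n}) X : (exists i, i \in S) ->
  SMA R (restrict_rel rho S) X ->
  exists i (r : R[i]) (X' : 'M[R[i]]_n),
    [/\ i \in S, SMA R (restrict_rel rho S) X', X' *m E i i = r *: E i i &
        fixed_point X' -> fixed_point X].
Proof.
move=> S0 AX; have [i0 i0S i0min] := minimal_class S0.
have rS_qo := restrict_rel_qo S rho_qo.
pose P (v : 'cV[R[i]]_n) := forall p, v p 0 != 0 -> p \in S /\ rho p i0.
have [|||r [v [Pv v0 Xv]]] := @stable_eigenvector _ n X P (delta_mx i0 0).
- move=> w r Pw p; rewrite !mx_entryE mxE.
  have [/Pw//|] := boolP (w p 0 != 0); rewrite negbK => /eqP ->.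
  rewrite mulr0 subr0 => sum0.
  have [q] : exists q, X p q * w q 0 != 0.
    apply: contrapT => /forallNP X0; move/negP: sum0; apply.
    by rewrite big1 // => q _; apply/eqP/negPn/negP; exact: X0.
  rewrite mulf_eq0 negb_or => /andP[Xpq /Pw[qS rq]].
  have : restrict_rel rho S p q by apply: contraNT Xpq => /AX ->.
  rewrite /restrict_rel; have [->|_] := eqVneq p q; first by [].
  by move=> /= /and3P[rpq pS _]; split=> //; exact: (proj2 rho_qo) rpq rq.
- move=> p; rewrite mxE; have [->|] := eqVneq p i0; last by rewrite /= eqxx.
  by split=> //; exact: (proj1 rho_qo).
- by apply/cV0Pn; exists i0; rewrite mxE !eqxx oner_eq0.
have /cV0Pn[i vi] := v0; have [iS rii0] := Pv i vi.
(* Column [i] of [1 + N] is [v] normalized to have entry [1] at [i]. *)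
pose N : 'M[R[i]]_n := \matrix_(p, q) if (q == i) && (p != i) then v p 0 / v i 0 else 0.
have N_neq0 p q : N p q != 0 -> [/\ q = i, p != i, p \in S & rho p i].
  rewrite mxE; have [->|_] := eqVneq q i; last by rewrite eqxx.
  have [_|pi] := eqVneq p i; first by rewrite eqxx.
  rewrite mulf_eq0 negb_or => /andP[/Pv[pS rp] _]; split=> //.
  exact: (proj2 rho_qo) rp (i0min i iS rii0).
have AN : SMA R (restrict_rel rho S) N.
  move=> p q rpq; apply/eqP/negPn/negP => /N_neq0[qi pi pS rpi].
  by rewrite /restrict_rel qi rpi pS iS orbT in rpq.
have NN : N *m N = 0.
  apply/matrixP => p q; rewrite !mxE big1 // => w _.
  have [->|/N_neq0[-> _ _ _]] := eqVneq (N p w) 0; first by rewrite mul0r.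
  by rewrite [N i q]mxE eqxx andbF mulr0.
pose e : 'cV[R[i]]_n := delta_mx i 0.
have VV : (1%:M - N) *m (1%:M + N) = 1%:M.
  by rewrite mulmxBl !mulmxDr !mul1mx mulmx1 NN addr0 addrK.
have Ve : (1%:M + N) *m e = (v i 0)^-1 *: v.
  apply/colP => p; rewrite mulmxDl mul1mx mx_entryE -colE !mxE eqxx eqxx andbT /=.
  by have [->|pi] := eqVneq p i; rewrite ?addr0 ?mulVf // add0r mulrC.
exists i, r, ((1%:M - N) *m X *m (1%:M + N)); split=> //.
- have A1 := SMA_scalar rS_qo (1 : R[i]).
  by apply: SMA_mul => //; [apply: SMA_mul => //; exact: SMA_sub|exact: SMA_add].
- have -> : E i i = e *m delta_mx 0 i by rewrite mul_delta_mx.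
  rewrite mulmxA -(mulmxA _ _ e) Ve -!scalemxAr -(mulmxA _ X) Xv -scalemxAr scalerA mulrC.
  by rewrite -scalerA scalemxAr -Ve mulmxA VV mul1mx -scalemxAl.
apply: (@fixed_point_unip [set i]%SET); first exact: restrict_SMA AN.
by move=> p q /N_neq0[-> pi _ _]; rewrite !inE pi eqxx.
Qed.

End FixedPoints.

(** In blocks for [e] and its complement, the matrix has corner [mu], row [r] and block [Y]. The
    conjugating [N = r *m G] solves the Sylvester equation [N Y - mu N = r]. *)
Lemma clear_row_conj (F : fieldType) (n : nat) (e r Y G : 'M[F]_n) (mu : F) :
  e *m r = r -> r *m e = 0 -> e *m Y = 0 -> Y *m e = 0 ->
  (Y - mu%:M) *m G = 1%:M ->
  [/\ e *m (r *m G) = r *m G, (r *m G) *m e = 0 &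
      (1%:M - r *m G) *m (mu *: e + r + Y) *m (1%:M + r *m G) = mu *: e + Y].
Proof.
move=> er re eY Ye GG.
have Ge : G *m e = e *m G.
  have eC : e *m (Y - mu%:M) = (Y - mu%:M) *m e.
    by rewrite mulmxBr mulmxBl eY Ye scalar_mxC.
  have GG' := mulmx1C GG.
  by rewrite -[G *m e]mulmx1 -GG mulmxA -(mulmxA G) eC mulmxA GG' mul1mx.
set N := r *m G.
have eN : e *m N = N by rewrite /N mulmxA er.
have Ne : N *m e = 0 by rewrite /N -mulmxA Ge mulmxA re mul0mx.
have NN : N *m N = 0 by rewrite -{2}eN mulmxA Ne mul0mx.
have rN : r *m N = 0 by rewrite -{1}eN mulmxA re mul0mx.
have YN : Y *m N = 0 by rewrite -{1}eN mulmxA Ye mul0mx.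
have Nr : N *m r = 0 by rewrite -er mulmxA Ne mul0mx.
have NY : N *m Y = r + mu *: N.
  have : N *m (Y - mu%:M) = r by rewrite /N -mulmxA (mulmx1C GG) mulmx1.
  by rewrite mulmxBr mul_mx_scalar => /eqP; rewrite subr_eq => /eqP.
split=> //.
have -> : (1%:M - N) *m (mu *: e + r + Y) = mu *: e + Y - mu *: N.
  rewrite mulmxBl mul1mx !mulmxDr -scalemxAr Ne Nr NY scaler0 !add0r.
  by apply/matrixP => p q; rewrite !mx_entryE; ring.
rewrite mulmxDr mulmx1 mulmxBl mulmxDl -!scalemxAl eN YN NN scaler0 subr0 addr0.
by rewrite addrNK.
Qed.

Section Fixed.
Variables (R : realType) (n : nat) (rho : rel 'I_n).
Hypotheses (rho_qo : quasi_order rho) (third : has_third rho).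
Local Notation E := delta_mx.
Implicit Types X : 'M[R[i]]_n.

Lemma fixed_point_limit X Y : SMA R rho X -> SMA R rho Y ->
  (forall N, exists2 m, (N <= m)%N & fixed_point rho (X + m.+1%:R^-1 *: Y)) ->
  fixed_point rho X.
Proof.
move=> AX AY frq phi phi_fix.
apply: (line_limit (D := SMA R rho) (Y := Y) (M := Y)) => //.
  exact: adm_line (fix_adm phi_fix).
by move=> N; have [m Nm fX] := frq N; exists m => //; exact: fX.
Qed.

(* Adding a small multiple of [E i i] moves the eigenvalue [r] off the spectrum of
   the complementary block, after which row [i] can be conjugated away. *)
Lemma clear_row (S : {set 'I_n}) (i : 'I_n) (r : R[i]) X :
  (forall Y, SMA R (restrict_rel rho (S :\ i)%SET) Y -> fixed_point rho Y) ->
  SMA R (restrict_rel rho S) X -> X *m E i i = r *: E i i ->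
  fixed_point rho X.
Proof.
move=> IH AX Xi.
have rS_qo := restrict_rel_qo S rho_qo.
have AE : SMA R (restrict_rel rho S) (E i i) by apply: SMA_delta; exact: (proj1 rS_qo).
have EE : E i i *m E i i = E i i :> 'M[R[i]]_n by rewrite mul_delta_mx.
pose Rr := E i i *m X - r *: E i i.
pose Y := X - E i i *m X.
have eR : E i i *m Rr = Rr by rewrite /Rr mulmxBr mulmxA EE -scalemxAr EE.
have Re : Rr *m E i i = 0.
  by rewrite /Rr mulmxBl -mulmxA Xi -scalemxAr -scalemxAl EE subrr.
have eY : E i i *m Y = 0 by rewrite /Y mulmxBr mulmxA EE subrr.
have Ye : Y *m E i i = 0 by rewrite /Y mulmxBl -mulmxA Xi -scalemxAr EE subrr.
have AeX : SMA R (restrict_rel rho S) (E i i *m X) by exact: SMA_mul.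
have AR : SMA R (restrict_rel rho S) Rr by apply: SMA_sub => //; exact: SMA_scale.
have AY : SMA R (restrict_rel rho S) Y by exact: SMA_sub.
apply: (fixed_point_limit (Y := E i i)).
- exact: restrict_SMA AX.
- exact: restrict_SMA AE.
(* A nonroot [e] of this characteristic polynomial makes [Y - (r + e)] invertible. *)
move=> N; have [m Nm root_m] := frequently_nonroot N (monic_neq0 (char_poly_monic (Y - r%:M))).
exists m => //; set e : R[i] := _^-1 in root_m *.
pose mu := r + e.
have Gunit : Y - mu%:M \in unitmx.
  rewrite unitmxE unitfE; apply: contra root_m => /det0P[v v0 vG].
  rewrite -eigenvalue_root_char; apply/eigenvalueP; exists v => //.
  apply/eqP; rewrite -subr_eq0 -mul_mx_scalar -mulmxBr -addrA -opprD -raddfD /=.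
  by rewrite vG.
have AG : SMA R (restrict_rel rho S) (invmx (Y - mu%:M)).
  by apply: SMA_inv => //; apply: SMA_sub => //; exact: SMA_scalar.
have [eN Ne conjE] := clear_row_conj eR Re eY Ye (mulmxV Gunit).
have AN : SMA R (restrict_rel rho S) (Rr *m invmx (Y - mu%:M)) by exact: SMA_mul.
set W := Rr *m _ in eN Ne conjE AN; clearbody W.
have -> : X + e *: E i i = mu *: E i i + Rr + Y.
  by rewrite /mu /Rr /Y; apply/matrixP => p q; rewrite !mx_entryE; ring.
clearbody Y.
apply: (@fixed_point_unip _ _ _ rho_qo third (~: [set i])%SET W).
- exact: restrict_SMA AN.
- move=> p q; rewrite !inE negbK; have [->|pi] := eqVneq p i.
    have [->|//] := eqVneq q i.
    by have /matrixP/(_ i i) := Ne; rewrite mulmx_delta eqxx mulr1 mxE => ->; rewrite eqxx.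
  have /matrixP/(_ p q) := eN; rewrite delta_mulmx (negPf pi) mul0r => <-.
  by rewrite eqxx.
(* Row and column [i] are now diagonal, so the induction hypothesis for [S] without [i] applies. *)
rewrite conjE; apply: IH => p q; rewrite /restrict_rel negb_or => /andP[pq].
rewrite !inE => rpq.
rewrite !mx_entryE [E i i p q]mxE.
have [pi|pi] := eqVneq p i.
  have := congr1 (fun M : 'M[R[i]]_n => M p q) eY.
  rewrite delta_mulmx mxE -pi eqxx mul1r => ->.
  by have [qp|_] := eqVneq q p; [rewrite qp eqxx in pq|rewrite mulr0 addr0].
rewrite mulr0 add0r; have [qi|qi] := eqVneq q i.
  by have := congr1 (fun M : 'M[R[i]]_n => M p q) Ye; rewrite mulmx_delta mxE -qi eqxx mulr1.
apply: AY; rewrite /restrict_rel (negPf pq) /=.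
by move: rpq; rewrite pi qi.
Qed.

(** Induction on [S]: [clear_column] and [clear_row] detach one index at a time, and for empty [S]
    the matrix is diagonal. *)
Lemma fixes_units_id (phi : 'M[R[i]]_n -> 'M[R[i]]_n) X :
  fixes_units rho phi -> SMA R rho X -> phi X = X.
Proof.
move=> phi_fix AX.
suff fS (S : {set 'I_n}) Y : SMA R (restrict_rel rho S) Y -> fixed_point rho Y.
  apply: (fS [set: 'I_n]%SET) phi_fix => p q; rewrite /restrict_rel !inE !andbT negb_or.
  by move=> /andP[_ /AX].
have [k] := ubnP #|S|; elim: k S Y => // k IH S Y Sk AY.
have [[i0 i0S]|S0] := pselect (exists i, i \in S); last first.
  move=> psi psi_fix.
  have -> : Y = diag_mx (\row_p Y p p).
    apply/matrixP => p q; rewrite !mxE; have [->|pq] := eqVneq p q; first by [].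
    rewrite mulr0n; apply: AY; rewrite /restrict_rel (negPf pq) /=.
    by apply/negP => /and3P[_ pS _]; apply: S0; exists p.
  exact: (fix_diag psi_fix (\row_p Y p p)).
have [i [r [X' [iS AX' X'i]]]] := clear_column rho_qo third (ex_intro _ i0 i0S) AY.
apply; apply: (clear_row (S := S) _ AX' X'i) => Z; apply: IH.
by move: Sk; rewrite (cardsD1 i) iS.
Qed.

End Fixed.

(** * Hadamard multipliers *)

(** Hadamard maps and partial transposes are linear and fix scalar matrices, so for them spectrum
    preservation becomes preservation of units. *)
Lemma eigenvalue_unitmx (F : fieldType) (n : nat) (X : 'M[F]_n) (a : F) :
  eigenvalue X a = (X - a%:M \notin unitmx).
Proof.
rewrite unitmxE unitfE negbK; apply/eigenvalueP/det0P => -[v].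
  by move=> vX v0; exists v; rewrite // mulmxBr vX mul_mx_scalar subrr.
move=> v0 /eqP; rewrite mulmxBr mul_mx_scalar subr_eq0 => /eqP vX.
by exists v.
Qed.

Definition hadamard (F : fieldType) (n : nat) (c : 'I_n -> 'I_n -> F) (X : 'M[F]_n) : 'M[F]_n :=
  \matrix_(p, q) (c p q * X p q).

Section Hadamard.
Variables (R : realType) (n : nat) (rho : rel 'I_n).
Hypothesis rho_qo : quasi_order rho.
Local Notation A := (SMA R rho).
Local Notation E := delta_mx.

(** A multiplicative cocycle on [rho]; this makes [hadamard c] an automorphism of the algebra. *)
Definition transitive_map (c : 'I_n -> 'I_n -> R[i]) : Prop :=
  (forall p q, rho p q -> c p q != 0) /\
  (forall p q r, rho p q -> rho q r -> c p q * c q r = c p r).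

Lemma transitive_mapV c : transitive_map c -> transitive_map (fun p q => (c p q)^-1).
Proof.
move=> [c0 cM]; split=> [p q /c0|p q r pq qr]; first by rewrite invr_eq0.
by rewrite -invfM cM.
Qed.

Lemma transitive_map_refl c p : transitive_map c -> c p p = 1.
Proof.
move=> [c0 cM]; have rp := proj1 rho_qo p.
by apply: (mulfI (c0 _ _ rp)); rewrite cM // mulr1.
Qed.

Section OneMap.
Variable c : 'I_n -> 'I_n -> R[i].
Hypothesis c_tr : transitive_map c.

Lemma SMA_hadamard X : A X -> A (hadamard c X).
Proof. by move=> AX p q pq; rewrite mxE AX // mulr0. Qed.

Lemma hadamard_line X Y a : hadamard c (X + a *: Y) = hadamard c X + a *: hadamard c Y.
Proof. by apply/matrixP => p q; rewrite !mxE; ring. Qed.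

Lemma hadamard_mul X Y : A X -> A Y ->
  hadamard c (X *m Y) = hadamard c X *m hadamard c Y.
Proof.
move=> AX AY; apply/matrixP => p q; rewrite !mxE mulr_sumr; apply: eq_bigr => w _.
rewrite !mxE; have [pw|/AX ->] := boolP (rho p w); last by rewrite !(mul0r, mulr0).
have [wq|/AY ->] := boolP (rho w q); last by rewrite !(mul0r, mulr0).
by rewrite -(proj2 c_tr _ _ _ pw wq) mulrACA.
Qed.

Lemma hadamard_diag d : hadamard c (diag_mx d) = diag_mx d.
Proof.
apply/matrixP => p q; rewrite !mxE; have [->|_] := eqVneq p q; last by rewrite !mulr0n mulr0.
by rewrite transitive_map_refl // mul1r.
Qed.

Lemma hadamard_delta p q : hadamard c (E p q) = c p q *: E p q.
Proof.
apply/matrixP => u v; rewrite !mxE; have [->|_] := eqVneq u p; last by rewrite !mulr0.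
by have [->|_] := eqVneq v q; rewrite ?mulr0.
Qed.

Lemma hadamard_unit X : A X -> X \in unitmx -> hadamard c X \in unitmx.
Proof.
move=> AX Xunit; have AX' := SMA_inv rho_qo AX Xunit.
have : hadamard c X *m hadamard c (invmx X) = 1%:M.
  by rewrite -hadamard_mul // mulmxV // -diag_const_mx hadamard_diag.
by case/mulmx1_unit.
Qed.

End OneMap.

Lemma hadamardK c X : transitive_map c -> A X ->
  hadamard (fun p q => (c p q)^-1) (hadamard c X) = X.
Proof.
move=> [c0 _] AX; apply/matrixP => p q; rewrite !mxE.
have [/c0 cpq|/AX ->] := boolP (rho p q); last by rewrite !mulr0.
by rewrite mulKf.
Qed.

Lemma hadamard_eigenvalue c X : transitive_map c -> A X ->
  eigenvalue (hadamard c X) =1 eigenvalue X.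
Proof.
move=> c_tr AX a; rewrite !eigenvalue_unitmx; congr (~~ _).
have AXa : A (X - a%:M) by apply: SMA_sub => //; exact: SMA_scalar.
have -> : hadamard c X - a%:M = hadamard c (X - a%:M).
  have := hadamard_line c X (a%:M) (- 1); rewrite !scaleN1r => ->.
  by rewrite -diag_const_mx hadamard_diag.
apply/idP/idP; last exact: hadamard_unit.
rewrite -[X in _ -> X \in _](hadamardK c_tr AXa).
exact: hadamard_unit (transitive_mapV c_tr) _ (SMA_hadamard c AXa).
Qed.

Lemma admissible_hadamard phi c : transitive_map c ->
  admissible A phi -> admissible A (fun X => phi (hadamard c X)).
Proof.
move=> c_tr phi_adm; split.
- move=> X Y i j AX AY.
  have := @adm_line _ _ _ _ phi_adm _ _ i j (SMA_hadamard c AX) (SMA_hadamard c AY).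
  by under eq_fun do rewrite -hadamard_line.
- move=> X Y /set_mem AX /set_mem AY.
  move/(adm_inj phi_adm (mem_set (SMA_hadamard c AX)) (mem_set (SMA_hadamard c AY))).
  move/(congr1 (hadamard (fun p q => (c p q)^-1))).
  by rewrite (hadamardK c_tr AX) (hadamardK c_tr AY).
- move=> X Y AX AY XY; apply: (adm_comm phi_adm (SMA_hadamard c AX) (SMA_hadamard c AY)).
  by rewrite -!hadamard_mul // XY.
- move=> X AX a; rewrite (adm_spec phi_adm (SMA_hadamard c AX)).
  exact: hadamard_eigenvalue.
Qed.

(** Homogeneity in [x] and the cocycle identity for distinct indices come from [chain_units], every
    unit being part of a chain. *)
Lemma scaled_units phi : has_third rho -> admissible A phi ->
  (forall d, phi (diag_mx d) = diag_mx d) ->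
  (forall p q, rho p q -> p != q -> exists2 c, c != 0 & phi (E p q) = c *: E p q) ->
  exists2 c, transitive_map c &
    forall p q x, rho p q -> phi (x *: E p q) = (c p q * x) *: E p q.
Proof.
move=> third phi_adm phi_diag phi_unit.
have phi_unit' p q : rho p q -> exists2 c, c != 0 & phi (E p q) = c *: E p q.
  move=> rpq; have [->|pq] := eqVneq p q; last exact: phi_unit.
  exists 1; rewrite ?oner_neq0 // scale1r; exact: phi_delta.
have /choice[c cP] (pq : 'I_n * 'I_n) : exists c, rho pq.1 pq.2 ->
    c != 0 /\ phi (E pq.1 pq.2) = c *: E pq.1 pq.2.
  have [/phi_unit'[c c0 phiE]|] := boolP (rho pq.1 pq.2); first by exists c.
  by exists 0.
have c0 p q : rho p q -> c (p, q) != 0 by move/(cP (p, q)) => [].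
have phiE p q : rho p q -> phi (E p q) = c (p, q) *: E p q by move/(cP (p, q)) => [].
have chain p q r : p != q -> p != r -> q != r -> rho p q -> rho q r ->
    [/\ c (p, q) * c (q, r) = c (p, r),
        forall x, phi (x *: E p q) = (c (p, q) * x) *: E p q,
        forall x, phi (x *: E q r) = (c (q, r) * x) *: E q r &
        forall x, phi (x *: E p r) = (c (p, r) * x) *: E p r].
  move=> pq pr qr rpq rqr; have rpr : rho p r by exact: (proj2 rho_qo) rpq rqr.
  have [c12 [c23 [cE e12 e23 e13]]] :=
    chain_units rho_qo phi_adm phi_diag pq pr qr rpq rqr (c0 _ _ rpr) (phiE _ _ rpr).
  have c12E : c12 = c (p, q).
    by apply: (@scale_delta_inj _ _ p q); rewrite -phiE // -[E p q in RHS]scale1r e12 mulr1.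
  have c23E : c23 = c (q, r).
    by apply: (@scale_delta_inj _ _ q r); rewrite -phiE // -[E q r in RHS]scale1r e23 mulr1.
  by rewrite c12E c23E in cE e12 e23; split.
have cpp p : c (p, p) = 1.
  apply: (@scale_delta_inj _ _ p p); rewrite -phiE ?scale1r; last exact: (proj1 rho_qo).
  exact: phi_delta.
have third' p q : rho p q -> p != q -> exists m, [/\ m != p, m != q, p != m, q != m &
    [|| rho m p, rho q m | rho p m && rho m q]].
  move=> rpq pq; have [m [mp mq h]] := third_chain third rpq pq.
  by exists m; split; rewrite // eq_sym.
exists (fun p q => c (p, q)); first split; first exact: c0.
  move=> p q r rpq rqr.
  have [<-|pq] := eqVneq p q; first by rewrite cpp mul1r.
  have [<-|qr] := eqVneq q r; first by rewrite cpp mulr1.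
  (* The case [r = p], that is [c p q * c q p = 1], follows from two chains through a third index,
     by cancelling a nonzero constant. *)
  have [pr|pr] := eqVneq p r; last by have [] := chain p q r pq pr qr rpq rqr.
  rewrite -pr cpp; rewrite -pr in rqr.
  have qp : q != p by rewrite eq_sym.
  have [m [mp mq pm qm h]] := third' p q rpq pq.
  have [rmp|nrmp] := boolP (rho m p).
    have rmq : rho m q by exact: (proj2 rho_qo) rmp rpq.
    have [c1 _ _ _] := chain m p q mp mq pq rmp rpq.
    have [c2 _ _ _] := chain m q p mq mp qp rmq rqr.
    by apply: (mulfI (c0 _ _ rmp)); rewrite mulrA c1 c2 mulr1.
  have rqm : rho q m.
    case/or3P: h => [rmp|//|/andP[rpm _]]; first by rewrite rmp in nrmp.
    exact: (proj2 rho_qo) rqr rpm.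
  have rpm : rho p m by exact: (proj2 rho_qo) rpq rqm.
  have [c1 _ _ _] := chain q p m qp qm pm rqr rpm.
  have [c2 _ _ _] := chain p q m pq pm qm rpq rqm.
  by apply: (mulIf (c0 _ _ rpm)); rewrite -mulrA c1 c2 mul1r.
move=> p q x rpq; have [<-|pq] := eqVneq p q.
  rewrite cpp mul1r scaled_delta; exact: phi_diag.
have [m [mp mq pm qm]] := third' p q rpq pq.
case/or3P => [rmp|rqm|/andP[rpm rmq]].
- by have [] := chain m p q mp mq pq rmp rpq.
- by have [] := chain p q m pq pm qm rpq rqm.
- by have [] := chain p m q pm pq mq rpm rmq.
Qed.

(** Precomposing [phi] with the inverse Hadamard automorphism yields a map that fixes the units,
    hence the identity. *)
Lemma admissible_hadamardE phi c X : has_third rho -> admissible A phi ->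
  (forall d, phi (diag_mx d) = diag_mx d) -> transitive_map c ->
  (forall p q x, rho p q -> phi (x *: E p q) = (c p q * x) *: E p q) ->
  A X -> phi X = hadamard c X.
Proof.
move=> third phi_adm phi_diag c_tr phiE AX.
have cV_tr := transitive_mapV c_tr.
have fix_psi : fixes_units rho (fun X => phi (hadamard (fun p q => (c p q)^-1) X)).
  split; first exact: admissible_hadamard.
    by move=> d; rewrite hadamard_diag.
  move=> p q rpq; rewrite hadamard_delta phiE // mulfV ?scale1r //.
  exact: (proj1 c_tr).
have := fixes_units_id rho_qo third fix_psi (SMA_hadamard c AX).
by rewrite hadamardK.
Qed.

End Hadamard.

(** * Types of the images of matrix units *)

Section PairType.
Variables (F : fieldType) (n : nat).
Local Notation E := delta_mx.
Implicit Types (M N : 'M[F]_n) (a b c : 'I_n).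

Definition supported (a b : 'I_n) M : Prop :=
  forall p q, M p q != 0 -> ((p == a) || (p == b)) && ((q == a) || (q == b)).

Lemma supportedC a b M : supported a b M -> supported b a M.
Proof. by move=> sM p q /sM; rewrite orbC [X in _ && X]orbC. Qed.

Lemma supported_eq0 a b M p q : supported a b M ->
  ~~ (((p == a) || (p == b)) && ((q == a) || (q == b))) -> M p q = 0.
Proof. by move=> sM; apply: contraNeq => /sM. Qed.

Lemma supported_eq a b M N : supported a b M -> supported a b N ->
  M a a = N a a -> M a b = N a b -> M b a = N b a -> M b b = N b b -> M = N.
Proof.
move=> sM sN aa ab ba bb; apply/matrixP => p q.
have [|npq] := boolP (((p == a) || (p == b)) && ((q == a) || (q == b))).
  by case/andP => /orP[]/eqP-> /orP[]/eqP->.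
by rewrite (supported_eq0 sM npq) (supported_eq0 sN npq).
Qed.

Lemma supported_delta a b x : supported a b (x *: E a b).
Proof.
move=> p q; rewrite !mxE; have [->|] := eqVneq p a; last by rewrite mulr0 eqxx.
by have [->|] := eqVneq q b; rewrite ?orbT // mulr0 eqxx.
Qed.

End PairType.

(** What is known of [phi (E a b)] before deciding between a multiple of [E a b] and one of
    [E b a]. *)
Record nil_block (F : fieldType) (n : nat) (a b : 'I_n) (M : 'M[F]_n) : Prop := NilBlock {
  nb_supp : supported a b M;
  nb_neq0 : M != 0;
  nb_eig : forall x, eigenvalue M x -> x = 0 }.

Lemma nil_blockC (F : fieldType) (n : nat) (a b : 'I_n) (M : 'M[F]_n) :
  nil_block a b M -> nil_block b a M.
Proof. by case=> sM M0 eM; split=> //; exact: supportedC. Qed.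

Section NilBlock.
Variables (F : fieldType) (n : nat).
Local Notation E := delta_mx.
Implicit Types (M N : 'M[F]_n) (a b c : 'I_n).

Lemma nil_block_diag a b M : a != b -> nil_block a b M -> M a b = 0 -> M a a = 0.
Proof.
move=> ab [sM _ eM] Mab; apply: eM; apply: eigenvalue_diag_entry => q qa.
have [->//|qb] := eqVneq q b.
by apply: supported_eq0 sM _; rewrite (negPf qa) (negPf qb) andbF.
Qed.

Lemma nil_block_upper a b M : a != b -> nil_block a b M -> M a a = 0 -> M b a = 0 ->
  M = M a b *: E a b.
Proof.
move=> ab nM Maa Mba; have ba : b != a by rewrite eq_sym.
have Mbb := nil_block_diag ba (nil_blockC nM) Mba.
apply: (supported_eq (nb_supp nM) (@supported_delta _ _ a b (M a b))).
all: by rewrite ?Maa ?Mba ?Mbb !mxE ?eqxx ?(negPf ab) ?(negPf ba) /= ?mulr0 ?mulr1.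
Qed.

Lemma nil_block_lower a b M : a != b -> nil_block a b M -> M a a = 0 -> M a b = 0 ->
  M = M b a *: E b a.
Proof.
move=> ab nM Maa Mab; have ba : b != a by rewrite eq_sym.
have [sM M0 eM] := nM.
have rowa q : M a q = 0.
  have [->//|qa] := eqVneq q a; have [->//|qb] := eqVneq q b.
  by apply: supported_eq0 sM _; rewrite (negPf qa) (negPf qb) andbF.
have rowp p q : p != b -> M p q = 0.
  have [->//|pa] := eqVneq p a => pb.
  by apply: supported_eq0 sM _; rewrite (negPf pa) (negPf pb).
(* Only row [b] of [M] is nonzero, so it is itself a row eigenvector, with eigenvalue [M b b]. *)
have Mbb : M b b = 0.
  apply: eM; apply/eigenvalueP; exists (row b M).
    apply/rowP => q; rewrite !mxE (bigD1 b) //= big1 ?addr0 ?mxE // => p pb.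
    by rewrite rowp // mulr0.
  apply: contraNneq M0 => rb; apply/eqP/matrixP => p q; rewrite mxE.
  by have [->|/rowp//] := eqVneq p b; have /rowP/(_ q) := rb; rewrite !mxE.
apply: (supported_eq sM (supportedC (@supported_delta _ _ b a (M b a)))).
all: by rewrite ?Maa ?Mab ?Mbb !mxE ?eqxx ?(negPf ab) ?(negPf ba) /= ?mulr0 ?mulr1.
Qed.

(** The blocks share only [a], so both products run through [a], giving the entry equations [prodE].
    These kill [M a a] and [N a a], and then forbid opposite orientations. *)
Lemma nil_block_pair a b c M N : a != b -> a != c -> b != c ->
  nil_block a b M -> nil_block a c N -> M *m N = N *m M ->
  (M = M a b *: E a b /\ N = N a c *: E a c) \/
  (M = M b a *: E b a /\ N = N c a *: E c a).
Proof.
move=> ab ac bc nM nN MN.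
have ba : b != a by rewrite eq_sym.
have ca : c != a by rewrite eq_sym.
have cb : c != b by rewrite eq_sym.
have [sM M0 _] := nM; have [sN N0 _] := nN.
have prodE p q : M p a * N a q = N p a * M a q.
  have /matrixP/(_ p q) := MN; rewrite !mxE (bigD1 a) //= big1 ?addr0; last first.
    move=> w wa; have [->|wb] := eqVneq w b.
      by rewrite (supported_eq0 (q := q) sN) ?mulr0 // (negPf ba) (negPf bc).
    by rewrite (supported_eq0 (p := p) sM) ?mul0r // (negPf wa) (negPf wb) andbF.
  move=> ->; rewrite (bigD1 a) //= big1 ?addr0 // => w wa; have [->|wc] := eqVneq w c.
    by rewrite (supported_eq0 (q := q) sM) ?mulr0 // (negPf ca) (negPf cb).
  by rewrite (supported_eq0 (p := p) sN) ?mul0r // (negPf wa) (negPf wc) andbF.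
have Mac : M a c = 0 by apply: supported_eq0 sM _; rewrite (negPf ca) (negPf cb) andbF.
have Mca : M c a = 0 by apply: supported_eq0 sM _; rewrite (negPf ca) (negPf cb).
have Nab : N a b = 0 by apply: supported_eq0 sN _; rewrite (negPf ba) (negPf bc) andbF.
have Nba : N b a = 0 by apply: supported_eq0 sN _; rewrite (negPf ba) (negPf bc).
have e_ac := prodE a c; have e_ba := prodE b a; have e_bc := prodE b c.
have e_ab := prodE a b; have e_ca := prodE c a; have e_cb := prodE c b.
rewrite Mac ?mulr0 in e_ac; rewrite Nba mul0r in e_ba; rewrite Nba mul0r in e_bc.
rewrite Nab mulr0 in e_ab; rewrite Mca mul0r in e_ca; rewrite Mca mul0r in e_cb.
have Maa : M a a = 0.
  apply/eqP; apply: contraNT N0 => x0.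
  have Nac : N a c = 0 by move/eqP: e_ac; rewrite mulf_eq0 (negPf x0) => /eqP.
  have Nca : N c a = 0 by move/esym/eqP: e_ca; rewrite mulf_eq0 (negPf x0) orbF => /eqP.
  have Naa := nil_block_diag ac nN Nac.
  by rewrite (nil_block_upper ac nN Naa Nca) Nac scale0r.
have Naa : N a a = 0.
  apply/eqP; apply: contraNT M0 => x0.
  have Mba : M b a = 0 by move/eqP: e_ba; rewrite mulf_eq0 (negPf x0) orbF => /eqP.
  have Mab : M a b = 0 by move/esym/eqP: e_ab; rewrite mulf_eq0 (negPf x0) => /eqP.
  by rewrite (nil_block_upper ab nM Maa Mba) Mab scale0r.
have [Mab|Mab] := eqVneq (M a b) 0.
  have ME := nil_block_lower ab nM Maa Mab.
  have Mba : M b a != 0 by apply: contraNneq M0 => Mba; rewrite ME Mba scale0r.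
  have Nac : N a c = 0 by move/eqP: e_bc; rewrite mulf_eq0 (negPf Mba) => /eqP.
  by right; split=> //; exact: nil_block_lower ac nN Naa Nac.
have Nca : N c a = 0 by move/esym/eqP: e_cb; rewrite mulf_eq0 (negPf Mab) orbF => /eqP.
have NE := nil_block_upper ac nN Naa Nca.
have Nac : N a c != 0 by apply: contraNneq N0 => Nac; rewrite NE Nac scale0r.
have Mba : M b a = 0 by move/eqP: e_bc; rewrite mulf_eq0 (negPf Nac) orbF => /eqP.
by left; split=> //; exact: nil_block_upper ab nM Maa Mba.
Qed.

End NilBlock.

Section PartialTranspose.
Variables (F : fieldType) (n : nat) (b : pred 'I_n).
Implicit Types M N : 'M[F]_n.

(** Meaningful on matrices satisfying [bblock]: it transposes the block where [b] holds and leaves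
    the other one alone. *)
Definition ptrans M : 'M[F]_n := \matrix_(p, q) if b p then M q p else M p q.

Definition bblock M : Prop := forall p q, b p != b q -> M p q = 0.

Let P : 'M[F]_n := diag_mx (\row_p (b p)%:R).

(** In the form of a commutation, the block structure passes to inverses and to images under a
    commutativity preserver that fixes diagonal matrices. *)
Lemma bblockP M : bblock M <-> M *m P = P *m M.
Proof.
rewrite /P mul_mx_diag mul_diag_mx; split=> [bM|/matrixP PM p q bpq].
  apply/matrixP => p q; rewrite !mxE mulrC.
  by have [->//|/bM ->] := eqVneq (b p) (b q); rewrite !mulr0.
have := PM p q; rewrite !mxE; case: (b p) (b q) bpq => -[] // _.
  by rewrite mulr0 mul1r.
by rewrite mulr1 mul0r.
Qed.

Lemma bblock_inv M : M \in unitmx -> bblock M -> bblock (invmx M).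
Proof.
move=> Mu /bblockP MP; apply/bblockP.
rewrite -[invmx M *m P]mulmx1 -(mulmxV Mu) mulmxA -(mulmxA (invmx M)) -MP mulmxA.
by rewrite mulVmx // mul1mx.
Qed.

Lemma bblock_scalar a : bblock a%:M.
Proof.
by move=> p q; rewrite mxE; have [->|_] := eqVneq p q; rewrite ?eqxx ?mulr0n.
Qed.

Lemma bblock_sub M N : bblock M -> bblock N -> bblock (M - N).
Proof. by move=> bM bN p q bpq; rewrite !mxE bM // bN // subr0. Qed.

Lemma ptrans_bblock M : bblock M -> bblock (ptrans M).
Proof. by move=> bM p q bpq; rewrite mxE (bM p q) // (bM q p) 1?eq_sym // if_same. Qed.

Lemma ptransK M : bblock M -> ptrans (ptrans M) = M.
Proof.
move=> bM; apply/matrixP => p q; rewrite !mxE.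
case bp: (b p); case bq: (b q) => //.
  by rewrite (bM p q) ?(bM q p) ?bp ?bq.
Qed.

Lemma ptrans_line M N a : ptrans (M + a *: N) = ptrans M + a *: ptrans N.
Proof. by apply/matrixP => p q; rewrite !mxE; case: (b p). Qed.

Lemma ptrans_diag d : ptrans (diag_mx d) = diag_mx d.
Proof.
apply/matrixP => p q; rewrite !mxE eq_sym.
by have [->|_] := eqVneq p q; rewrite ?mulr0n if_same.
Qed.

(** Antimultiplicative on one block and multiplicative on the other, so symmetric expressions such
    as Jordan products and commutation relations are preserved. *)
Lemma ptrans_mul M N p q : bblock M -> bblock N ->
  (ptrans M *m ptrans N) p q = if b p then (N *m M) q p else (M *m N) p q.
Proof.
move=> bM bN; rewrite mxE; case bp: (b p); rewrite mxE; apply: eq_bigr => w _; rewrite !mxE bp.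
  case bw: (b w); first by rewrite mulrC.
  by rewrite (bM w p) ?bw ?bp // mul0r mulr0.
case bw: (b w) => //.
by rewrite (bM p w) ?bw ?bp // !mul0r.
Qed.

Lemma ptrans_jordan M N : bblock M -> bblock N ->
  ptrans (M *m N + N *m M) = ptrans M *m ptrans N + ptrans N *m ptrans M.
Proof.
move=> bM bN; apply/matrixP => p q.
by rewrite [RHS]mx_entryE !ptrans_mul // mxE; case: (b p); rewrite mx_entryE // addrC.
Qed.

Lemma ptrans_comm M N : bblock M -> bblock N -> M *m N = N *m M ->
  ptrans M *m ptrans N = ptrans N *m ptrans M.
Proof. by move=> bM bN MN; apply/matrixP => p q; rewrite !ptrans_mul // MN. Qed.

Lemma ptrans_unit M : bblock M -> M \in unitmx -> ptrans M \in unitmx.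
Proof.
move=> bM Mu; have : ptrans M *m ptrans (invmx M) = 1%:M.
  apply/matrixP => p q; rewrite ptrans_mul //; last exact: bblock_inv.
  by rewrite mulVmx // mulmxV // !mxE eq_sym if_same.
by case/mulmx1_unit.
Qed.

Lemma ptrans_eigenvalue M : bblock M -> eigenvalue (ptrans M) =1 eigenvalue M.
Proof.
move=> bM a; rewrite !eigenvalue_unitmx; congr (~~ _).
have bMa : bblock (M - a%:M) by apply: bblock_sub => //; exact: bblock_scalar.
have -> : ptrans M - a%:M = ptrans (M - a%:M).
  have := ptrans_line M (a%:M) (- 1); rewrite !scaleN1r => ->.
  by rewrite -diag_const_mx ptrans_diag.
apply/idP/idP; last exact: ptrans_unit.
by rewrite -[X in _ -> X \in _](ptransK bMa); apply: ptrans_unit; exact: ptrans_bblock.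
Qed.

End PartialTranspose.

Section Types.
Variables (R : realType) (n : nat) (rho : rel 'I_n).
Hypotheses (rho_qo : quasi_order rho) (third : has_third rho).
Local Notation A := (SMA R rho).
Local Notation E := delta_mx.
Variable phi : 'M[R[i]]_n -> 'M[R[i]]_n.
Hypothesis phi_adm : admissible A phi.
Hypothesis phi_diag : forall d, phi (diag_mx d) = diag_mx d.

(** [E i j] commutes with every other [E m m], which [phi] fixes, so outside the block only diagonal
    entries could survive; those are eigenvalues, hence zero. Injectivity and [phi 0 = 0] exclude
    the zero matrix. *)
Lemma phi_unit_nil i j : rho i j -> i != j -> nil_block i j (phi (E i j)).
Proof.
move=> rij ij; have AE := SMA_delta R rij.
have eig0 x : eigenvalue (phi (E i j)) x -> x = 0.
  rewrite (adm_spec phi_adm AE) => /eigenvalueP[v vE v0].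
  have : v *m E i j *m E i j = 0 by rewrite -mulmxA mul_delta_mx_0 1?eq_sym // mulmx0.
  rewrite vE -scalemxAl vE scalerA => /eqP; rewrite scaler_eq0 (negPf v0) orbF.
  by rewrite mulf_eq0 orbb => /eqP.
split=> //.
- have comm m : m != i -> m != j -> phi (E i j) *m E m m = E m m *m phi (E i j).
    move=> mi mj; rewrite -[E m m in LHS](phi_delta phi_diag) -[E m m in RHS](phi_delta phi_diag).
    apply: (adm_comm phi_adm AE); first by apply: SMA_delta; exact: (proj1 rho_qo).
    by rewrite !mul_delta_mx_0 // eq_sym.
  have entry_col p m : m != i -> m != j -> p != m -> phi (E i j) p m = 0.
    move=> mi mj pm; have /matrixP/(_ p m) := comm m mi mj.
    by rewrite mulmx_delta delta_mulmx eqxx mulr1 (negPf pm) mul0r.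
  have entry_row p m : m != i -> m != j -> p != m -> phi (E i j) m p = 0.
    move=> mi mj pm; have /matrixP/(_ m p) := comm m mi mj.
    by rewrite mulmx_delta delta_mulmx eqxx mul1r (negPf pm) mulr0.
  have entry_diag m : m != i -> m != j -> phi (E i j) m m = 0.
    move=> mi mj; apply: eig0; apply: eigenvalue_diag_entry => p pm; exact: entry_row.
  move=> p q; apply: contraNT; rewrite negb_and !negb_or => /orP[/andP[mi mj]|/andP[mi mj]].
    by have [->|qp] := eqVneq q p; rewrite ?entry_diag ?entry_row.
  by have [->|qp] := eqVneq p q; rewrite ?entry_diag ?entry_col.
apply/eqP => phi0.
have A0 : A 0 by move=> p q; rewrite mxE.
have phi00 : phi 0 = 0 by rewrite -[X in phi X](raddf0 (diag_mx (n := n))) phi_diag raddf0.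
have /matrixP/(_ i j)/eqP : E i j = 0 :> 'M[R[i]]_n.
  by apply: (adm_inj phi_adm); rewrite ?inE // phi0 phi00.
by rewrite !mxE !eqxx oner_eq0.
Qed.

(* The alternative is that [phi (E i j)] is a multiple of [E j i], see [straightP]. *)
Definition straight i j : bool := phi (E i j) i j != 0.

(** Units with the same tail commute, so [nil_block_pair] applies to their images; [straight_head]
    is the same for a common head. *)
Lemma straight_tail a b c : a != b -> a != c -> b != c -> rho a b -> rho a c ->
  straight a b = straight a c /\
  phi (E a b) = if straight a b then phi (E a b) a b *: E a b else phi (E a b) b a *: E b a.
Proof.
move=> ab ac bc rab rac; have nM := phi_unit_nil rab ab; have nN := phi_unit_nil rac ac.
have MN : phi (E a b) *m phi (E a c) = phi (E a c) *m phi (E a b).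
  apply: (adm_comm phi_adm); [exact: SMA_delta|exact: SMA_delta|].
  by rewrite !mul_delta_mx_0 // eq_sym.
have [[ME NE]|[ME NE]] := nil_block_pair ab ac bc nM nN MN.
  have st_ab : straight a b.
    by apply: contraNneq (nb_neq0 nM) => M0; rewrite ME M0 scale0r.
  have st_ac : straight a c.
    by apply: contraNneq (nb_neq0 nN) => N0; rewrite NE N0 scale0r.
  by rewrite st_ab st_ac.
have st_ab : straight a b = false.
  by rewrite /straight ME !mxE (negPf ab) mulr0 eqxx.
have st_ac : straight a c = false.
  by rewrite /straight NE !mxE (negPf ac) mulr0 eqxx.
by rewrite st_ab st_ac.
Qed.

Lemma straight_head a b c : a != b -> a != c -> b != c -> rho b a -> rho c a ->
  straight b a = straight c a /\
  phi (E b a) = if straight b a then phi (E b a) b a *: E b a else phi (E b a) a b *: E a b.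
Proof.
move=> ab ac bc rba rca.
have ba : b != a by rewrite eq_sym.
have ca : c != a by rewrite eq_sym.
have nM := phi_unit_nil rba ba; have nN := phi_unit_nil rca ca.
have MN : phi (E b a) *m phi (E c a) = phi (E c a) *m phi (E b a).
  apply: (adm_comm phi_adm); [exact: SMA_delta|exact: SMA_delta|].
  by rewrite !mul_delta_mx_0.
have [[ME NE]|[ME NE]] := nil_block_pair ab ac bc (nil_blockC nM) (nil_blockC nN) MN.
  have st_ba : straight b a = false.
    by rewrite /straight ME !mxE (negPf ba) mulr0 eqxx.
  have st_ca : straight c a = false.
    by rewrite /straight NE !mxE (negPf ca) mulr0 eqxx.
  by rewrite st_ba st_ca.
have st_ba : straight b a.
  by apply: contraNneq (nb_neq0 nM) => M0; rewrite ME M0 scale0r.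
have st_ca : straight c a.
  by apply: contraNneq (nb_neq0 nN) => N0; rewrite NE N0 scale0r.
by rewrite st_ba st_ca.
Qed.

Lemma straightP i j : rho i j -> i != j ->
  phi (E i j) = if straight i j then phi (E i j) i j *: E i j else phi (E i j) j i *: E j i.
Proof.
move=> rij ij; have [m [mi mj]] := third_chain third rij ij.
have ji : j != i by rewrite eq_sym.
have im : i != m by rewrite eq_sym.
have jm : j != m by rewrite eq_sym.
case/or3P => [rmi|rjm|/andP[rim rmj]].
- have rmj : rho m j by exact: (proj2 rho_qo) rmi rij.
  by have [] := straight_head ji jm im rij rmj.
- have rim : rho i m by exact: (proj2 rho_qo) rij rjm.
  by have [] := straight_tail ij im jm rij rim.
by have [] := straight_tail ij im jm rij rim.
Qed.

(** The composite unit [E l k] shares its tail with the first unit and its head with the second. *)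
Lemma straight_through l v k : rho l v -> rho v k -> l != v -> v != k ->
  straight l v = straight v k.
Proof.
move=> rlv rvk lv vk; have rlk : rho l k by exact: (proj2 rho_qo) rlv rvk.
have vl : v != l by rewrite eq_sym.
have kv : k != v by rewrite eq_sym.
have [lk|lk] := eqVneq l k; last first.
  have kl : k != l by rewrite eq_sym.
  have [-> _] := straight_tail lv lk vk rlv rlk.
  by have [-> _] := straight_head kl kv lv rlk rvk.
(* When [l = k] the composite is diagonal; the comparison goes around a third index instead. *)
rewrite -lk in rvk *.
have [m [ml mv h]] := third_chain third rlv lv.
have lm : l != m by rewrite eq_sym.
have vm : v != m by rewrite eq_sym.
have [rml|nrml] := boolP (rho m l).
  have rmv : rho m v by exact: (proj2 rho_qo) rml rlv.
  have [-> _] := straight_head vl vm lm rlv rmv.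
  have [-> _] := straight_tail mv ml vl rmv rml.
  by have [-> _] := straight_head lm lv mv rml rvk.
have rvm : rho v m.
  case/or3P: h => [rml|//|/andP[rlm _]]; first by rewrite rml in nrml.
  exact: (proj2 rho_qo) rvk rlm.
have rlm : rho l m by exact: (proj2 rho_qo) rlv rvm.
have [-> _] := straight_tail lv lm vm rlv rlm.
have [-> _] := straight_head ml mv lv rlm rvm.
by have [-> _] := straight_tail vm vl ml rvm rvk.
Qed.

(** A predicate on indices replaces the choice of components of [rho]; by [transposedP] any unit
    touching [v] gives the same answer. *)
Definition transposed v : bool :=
  `[< exists u, (rho u v /\ u != v /\ ~~ straight u v) \/ (rho v u /\ v != u /\ ~~ straight v u) >].

Lemma transposedP i j : rho i j -> i != j ->
  transposed i = ~~ straight i j /\ transposed j = ~~ straight i j.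
Proof.
move=> rij ij; split.
  apply/asboolP/idP => [[u [[rui [ui]]|[riu [iu]]]]|nst]; last by exists j; right.
    by rewrite (straight_through rui rij).
  have [->//|uj] := eqVneq u j.
  by have [-> _] := straight_tail iu ij uj riu rij.
apply/asboolP/idP => [[u [[ruj [uj]]|[rju [ju]]]]|nst]; last by exists i; left.
  have [->//|ui] := eqVneq u i.
  have ju : j != u by rewrite eq_sym.
  have ji : j != i by rewrite eq_sym.
  by have [-> _] := straight_head ju ji ui ruj rij.
by rewrite (straight_through rij rju).
Qed.

Lemma SMA_bblock X : A X -> bblock transposed X.
Proof.
move=> AX p q bpq; apply: AX; apply: contra bpq => rpq.
have [->//|pq] := eqVneq p q.
by have [-> ->] := transposedP rpq pq.
Qed.

Lemma phi_bblock X : A X -> bblock transposed (phi X).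
Proof.
move=> AX; apply/bblockP; rewrite -phi_diag; apply: (adm_comm phi_adm) => //.
  by apply: SMA_diag; exact: (proj1 rho_qo).
by apply/bblockP; exact: SMA_bblock.
Qed.

Lemma admissible_ptrans : admissible A (fun X => ptrans transposed (phi X)).
Proof.
split.
- move=> X Y i j AX AY; rewrite (_ : (fun _ => _) =
    (fun t : R => phi (X + t%:C%C *: Y)
       (if transposed i then j else i) (if transposed i then i else j))).
    exact: (@adm_line _ _ _ _ phi_adm X Y _ _ AX AY).
  by apply/funext => t; rewrite mxE; case: (transposed i).
- move=> X Y AX AY /(congr1 (ptrans transposed)).
  rewrite (ptransK (phi_bblock (set_mem AX))) (ptransK (phi_bblock (set_mem AY))).
  exact: adm_inj phi_adm _ _ AX AY.
- move=> X Y AX AY XY; apply: ptrans_comm; [exact: phi_bblock|exact: phi_bblock|].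
  exact: (adm_comm phi_adm AX AY XY).
- move=> X AX a; rewrite (ptrans_eigenvalue (phi_bblock AX)).
  exact: (adm_spec phi_adm AX a).
Qed.

(** After the partial transposition each unit goes to a multiple of itself, so the map is a Hadamard
    automorphism; transposing back recovers [phi]. *)
Lemma phi_form : exists2 c, transitive_map rho c &
  forall X, A X -> phi X = ptrans transposed (hadamard c X).
Proof.
have psi_diag d : ptrans transposed (phi (diag_mx d)) = diag_mx d.
  by rewrite phi_diag ptrans_diag.
have [|c c_tr cE] := scaled_units rho_qo third admissible_ptrans psi_diag.
  move=> p q rpq pq; have [tp tq] := transposedP rpq pq.
  have nM := phi_unit_nil rpq pq; have := straightP rpq pq.
  case st: (straight p q) => ME.
    exists (phi (E p q) p q).
      by apply: contraNneq (nb_neq0 nM) => M0; rewrite ME M0 scale0r.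
    rewrite {1}ME; move: (phi _ p q) => x; apply/matrixP => u v; rewrite !mxE.
    have [up|up] := eqVneq u p; first by rewrite up tp st.
    rewrite /= !mulr0; case: ifP => // tu.
    have [uq|uq] := eqVneq u q; first by rewrite uq tq st in tu.
    by rewrite andbF mulr0.
  exists (phi (E p q) q p).
    by apply: contraNneq (nb_neq0 nM) => M0; rewrite ME M0 scale0r.
  rewrite {1}ME; move: (phi _ q p) => x; apply/matrixP => u v; rewrite !mxE.
  case: ifP => tu; first by rewrite andbC.
  have [up|up] := eqVneq u p; first by rewrite up tp st in tu.
  have [uq|uq] := eqVneq u q; first by rewrite uq tq st in tu.
  by rewrite mulr0.
exists c => // X AX.
have := admissible_hadamardE rho_qo third admissible_ptrans psi_diag c_tr cE AX.
by rewrite /= => <-; rewrite (ptransK (phi_bblock AX)).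
Qed.

Lemma phi_jordan : jordan_embedding A phi.
Proof.
have [c c_tr phiE] := phi_form; split; first exact: adm_inj phi_adm.
  move=> a X Y AX AY; rewrite !phiE //; last first.
    by rewrite addrC; exact: SMA_line.
  by rewrite addrC hadamard_line ptrans_line addrC.
move=> X Y AX AY; have AXY := SMA_mul rho_qo AX AY; have AYX := SMA_mul rho_qo AY AX.
rewrite !phiE //; last exact: SMA_add.
have bX := SMA_bblock (SMA_hadamard c AX); have bY := SMA_bblock (SMA_hadamard c AY).
rewrite -ptrans_jordan // -!(hadamard_mul c_tr) //.
by have := hadamard_line c (X *m Y) (Y *m X) 1; rewrite !scale1r => ->.
Qed.

End Types.

Lemma admissible_jordan (R : realType) (n : nat) (rho : rel 'I_n) phi :
  quasi_order rho -> has_third rho -> admissible (SMA R rho) phi ->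
  jordan_embedding (SMA R rho) phi.
Proof.
move=> rho_qo third phi_adm.
have [T [T' [TT' phiT]]] := admissible_diag rho_qo phi_adm.
have A1 := SMA_scalar rho_qo (1 : R[i]).
have T'T := mulmx1C TT'.
pose psi X := T' *m phi X *m T.
have psi_adm : admissible (SMA R rho) psi.
  have := admissible_conj rho_qo A1 A1 (mulmx1 1%:M) TT' phi_adm.
  by under eq_fun do rewrite mulmx1 mul1mx.
have psi_diag d : psi (diag_mx d) = diag_mx d by rewrite /psi phiT (conj_cancel _ T'T).
have [_ psi_lin psi_mul] := phi_jordan rho_qo third psi_adm psi_diag.
split; first exact: adm_inj phi_adm.
  move=> a X Y AX AY; apply: (conj_inj TT').
  rewrite mulmxDr mulmxDl conj_scale; exact: psi_lin.
move=> X Y AX AY; apply: (conj_inj TT').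
rewrite mulmxDr mulmxDl -!(conj_mul _ _ TT'); exact: psi_mul.
Qed.

(** * A nonlinear map when a third index is missing *)

Section Twist.
Variables (C : numFieldType).
Implicit Types a b c : C.

(* Homogeneous of degree [0], so that it takes the same value at parallel vectors;
   [twist 0 0 0 = 1] because [0 / 0 = 0]. *)
Definition twist a b c : C := 1 + `|b| / (`|a| + `|b| + `|c|).

Let size_ge0 a b c : 0 <= `|a| + `|b| + `|c|.
Proof. by rewrite !addr_ge0. Qed.

Lemma size_eq0 a b c : `|a| + `|b| + `|c| = 0 -> [/\ a = 0, b = 0 & c = 0].
Proof.
move/eqP; rewrite paddr_eq0 ?addr_ge0 // paddr_eq0 // !normr_eq0.
by case/andP => /andP[/eqP-> /eqP->] /eqP->.
Qed.

Lemma twist_ge1 a b c : 1 <= twist a b c.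
Proof. by rewrite lerDl divr_ge0. Qed.

Lemma twist_gt0 a b c : 0 < twist a b c.
Proof. exact: lt_le_trans ltr01 (twist_ge1 a b c). Qed.

Lemma twist_le2 a b c : twist a b c <= 2.
Proof.
rewrite /twist -[2%:R]/(1 + 1) lerD2l.
have [s0|s0] := eqVneq (`|a| + `|b| + `|c|) 0; first by rewrite s0 invr0 mulr0.
have s_gt0 : 0 < `|a| + `|b| + `|c| by rewrite lt_def s0 size_ge0.
by rewrite ler_pdivrMr // mul1r [`|a| + _]addrC -addrA lerDl addr_ge0.
Qed.

(** Parallel nonzero vectors have equal [twist] by homogeneity; if one vector is zero, the products
    that enter commutators vanish. *)
Lemma twist_parallel a b c a' b' c' :
  a * b' = a' * b -> a * c' = a' * c -> b * c' = b' * c ->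
  twist a b c = twist a' b' c' \/ [/\ a * b' = 0, a * c' = 0 & b * c' = 0].
Proof.
move=> /(congr1 Num.norm) ab ac' /(congr1 Num.norm) bc.
rewrite !normrM in ab bc.
have [/size_eq0[-> -> ->]|s0] := eqVneq (`|a| + `|b| + `|c|) 0.
  by right; rewrite !mul0r.
have [/size_eq0[_ -> ->]|s0'] := eqVneq (`|a'| + `|b'| + `|c'|) 0.
  by right; rewrite !mulr0.
left; congr (1 + _); apply/eqP; rewrite eqr_div //; apply/eqP.
by rewrite !mulrDr [X in X + _ + _]mulrC -ab bc; ring.
Qed.

Lemma twist_mono a b c b' c' :
  `|b'| <= `|b| -> `|c| <= `|c'| -> twist a b' c' <= twist a b c.
Proof.
move=> bb cc; rewrite lerD2l.
have [->|b0'] := eqVneq b' 0; first by rewrite normr0 mul0r divr_ge0.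
have b'_gt0 : 0 < `|b'| by rewrite normr_gt0.
have b_gt0 : 0 < `|b| by exact: lt_le_trans b'_gt0 bb.
have pos (x y z : C) : 0 < `|y| -> 0 < `|x| + `|y| + `|z|.
  by move=> y0; rewrite -addrA addrCA; apply: ltr_wpDr => //; rewrite addr_ge0.
rewrite ler_pdivrMr ?pos // mulrAC ler_pdivlMr ?pos //.
rewrite !mulrDr [X in _ <= _ + X + _]mulrC lerD //.
  by rewrite lerD2r ler_wpM2r.
exact: ler_pM.
Qed.

(** If [u <= u'], the equations give [|b'| <= |b|] and [|c| <= |c'|], and then [twist_mono] gives
    [u' <= u]; symmetrically otherwise. Equality of the factors settles the rest. *)
Lemma twist_inj a b c b' c' :
  twist a b c * b = twist a b' c' * b' -> c / twist a b c = c' / twist a b' c' ->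
  b = b' /\ c = c'.
Proof.
set u := twist a b c; set u' := twist a b' c' => ub uc.
have u0 : 0 < u := twist_gt0 a b c; have u'0 : 0 < u' := twist_gt0 a b' c'.
suff uu : u = u'.
  rewrite uu in ub uc; split; first by apply: mulfI ub; rewrite gt_eqF.
  by apply: mulIf uc; rewrite invr_eq0 gt_eqF.
have nub : u * `|b| = u' * `|b'|.
  by have := congr1 Num.norm ub; rewrite !normrM (gtr0_norm u0) (gtr0_norm u'0).
have nuc : `|c| * u' = `|c'| * u.
  have := congr1 Num.norm uc; rewrite !normf_div (gtr0_norm u0) (gtr0_norm u'0).
  by move/eqP; rewrite eqr_div ?(gt_eqF u0) ?(gt_eqF u'0) // => /eqP.
have := real_leVge (gtr0_real u0) (gtr0_real u'0).
case/orP => le; apply/eqP; rewrite eq_le le ?andbT /=.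
  apply: twist_mono.
    by rewrite -(ler_pM2l u0) nub ler_wpM2r.
  by rewrite -(ler_pM2r u'0) nuc ler_wpM2l.
apply: twist_mono.
  by rewrite -(ler_pM2l u'0) -nub ler_wpM2r.
by rewrite -(ler_pM2r u0) -nuc ler_wpM2l.
Qed.

End Twist.

(** At a zero of [f] boundedness of [g] suffices; this covers the origin, where [twist] is
    discontinuous. *)
Lemma continuous_bounded_mul (K : numFieldType) (T : topologicalType) (f g : T -> K) (x : T) :
  {for x, continuous f} -> (forall y, `|g y| <= 2) ->
  f x = 0 \/ {for x, continuous g} -> {for x, continuous (fun y => f y * g y)}.
Proof.
move=> fx g2 [f0|gx]; last exact: cvgM fx gx.
rewrite /prop_for /continuous_at f0 mul0r; apply/cvgr0Pnorm_lt => e e0.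
have e2 : 0 < e / 2 by rewrite divr_gt0.
have : f y @[y --> x] --> 0 by rewrite -f0.
move/cvgr0Pnorm_lt => /(_ _ e2); apply: filterS => y fy.
rewrite normrM; apply: le_lt_trans (ler_wpM2l (normr_ge0 _) (g2 y)) _.
by rewrite -ltr_pdivlMr.
Qed.

Section TwistContinuous.
Variables (K : numFieldType) (T : topologicalType) (a b c : T -> K) (x : T).
Hypotheses (ax : {for x, continuous a}) (bx : {for x, continuous b})
  (cx : {for x, continuous c}).

Let u y := twist (a y) (b y) (c y).

Let u_cont : `|a x| + `|b x| + `|c x| != 0 -> {for x, continuous u}.
Proof.
move=> s0; have nb : `|b y| @[y --> x] --> `|b x| by apply: cvg_norm.
apply: cvgD; first exact: cvg_cst.
apply: cvgM => //; apply: cvgV => //; apply: cvgD; last exact: cvg_norm.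
by apply: cvgD => //; exact: cvg_norm.
Qed.

Lemma continuous_mul_twist : {for x, continuous (fun y => b y * u y)}.
Proof.
apply: continuous_bounded_mul => //.
  by move=> y; rewrite gtr0_norm ?twist_gt0 // twist_le2.
have [/size_eq0[_ -> _]|/u_cont] := eqVneq (`|a x| + `|b x| + `|c x|) 0; first by left.
by right.
Qed.

Lemma continuous_div_twist : {for x, continuous (fun y => c y * (u y)^-1)}.
Proof.
apply: continuous_bounded_mul => //.
  move=> y; rewrite gtr0_norm ?invr_gt0 ?twist_gt0 //.
  apply: (@le_trans _ _ 1); last by rewrite ler1n.
  by rewrite invf_le1 ?twist_gt0 // twist_ge1.
have [/size_eq0[_ _ ->]|/u_cont ux] := eqVneq (`|a x| + `|b x| + `|c x|) 0; first by left.
by right; apply: cvgV => //; rewrite gt_eqF // twist_gt0.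
Qed.

End TwistContinuous.

(** * The twisted map on matrices *)

Lemma mx_continuous (T U : topologicalType) (m n : nat) (f : T -> 'M[U]_(m, n)) :
  (forall p q, continuous (fun x => f x p q)) -> continuous f.
Proof.
move=> f_c x B [P nP PB].
have : \forall y \near x, forall pq : 'I_m * 'I_n, P pq.1 pq.2 (f y pq.1 pq.2).
  apply: (@filter_forall T ('I_m * 'I_n)%type (fun pq y => P pq.1 pq.2 (f y pq.1 pq.2)) (nbhs x)).
  by move=> [p q] /=; exact: f_c (nP p q).
by apply: filterS => y Py; apply: PB => p q; exact: (Py (p, q)).
Qed.

(** The rules for [E j i] are assumed only after scaling by [b'] and [b]: without [rho j i] they may
    fail, but these coefficients are then zero. *)
Lemma mul_add_deltas (F : fieldType) (n : nat) (i j : 'I_n) (Z W : 'M[F]_n)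
    (a b a' b' zii zij zji zjj wii wij wji wjj : F) :
  i != j ->
  Z *m delta_mx i j = zii *: delta_mx i j + zji *: delta_mx j j ->
  b' *: (Z *m delta_mx j i) = b' *: (zjj *: delta_mx j i + zij *: delta_mx i i) ->
  delta_mx i j *m W = wjj *: delta_mx i j + wji *: delta_mx i i ->
  b *: (delta_mx j i *m W) = b *: (wii *: delta_mx j i + wij *: delta_mx j j) ->
  (Z + a *: delta_mx i j + b *: delta_mx j i) *m
  (W + a' *: delta_mx i j + b' *: delta_mx j i) =
  Z *m W + (a' * zii + a * wjj) *: delta_mx i j + (b' * zjj + b * wii) *: delta_mx j i
  + (b' * zij + a * wji + a * b') *: delta_mx i i
  + (a' * zji + b * wij + b * a') *: delta_mx j j.
Proof.
move=> ij Zij Zji Wij Wji; rewrite !(mulmxDl, mulmxDr) -!scalemxAl -!scalemxAr.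
rewrite Zij Zji Wij Wji !mul_delta_mx_cond !eqxx (eq_sym j) (negPf ij).
rewrite !mulr0n !mulr1n !scaler0 !scalerA.
by apply/matrixP => p q; rewrite !mx_entryE [(0 : 'M[F]_n) p q]mxE; ring.
Qed.

Lemma eq_add4 (K : pzRingType) (V : lmodType K) (M M' P Q S T : V) (a b c d a' b' c' d' : K) :
  M = M' -> a = a' -> b = b' -> c = c' -> d = d' ->
  M + a *: P + b *: Q + c *: S + d *: T = M' + a' *: P + b' *: Q + c' *: S + d' *: T.
Proof. by move=> -> -> -> -> ->. Qed.

Section TwistMap.
Variables (R : realType) (n : nat) (rho : rel 'I_n) (i j : 'I_n).
Hypotheses (rho_qo : quasi_order rho) (rij : rho i j) (ij : i != j).
Hypothesis no_third : forall m, m != i -> m != j ->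
  rho m i || rho i m -> rho m j || rho j m -> False.
Local Notation A := (SMA R rho).
Local Notation E := delta_mx.
Implicit Types X Y : 'M[R[i]]_n.

Let ji : j != i. Proof. by rewrite eq_sym. Qed.

Let u X := twist (X i i - X j j) (X i j) (X j i).
Let al X := (u X - 1) * X i j.
Let be X := ((u X)^-1 - 1) * X j i.

(** Multiplies entry [(i, j)] by [u X] and divides entry [(j, i)] by it; the additive form makes
    products expandable by [mul_add_deltas]. *)
Definition twist_map X : 'M[R[i]]_n := X + al X *: E i j + be X *: E j i.

Let u_neq0 X : u X != 0.
Proof. by rewrite gt_eqF // twist_gt0. Qed.

Lemma twist_map_ij X : twist_map X i j = X i j * u X.
Proof. by rewrite /twist_map !mxE !eqxx (negPf ij) (negPf ji) /= /al; ring. Qed.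

Lemma twist_map_ji X : twist_map X j i = X j i * (u X)^-1.
Proof. by rewrite /twist_map !mxE !eqxx (negPf ij) (negPf ji) /= /be; ring. Qed.

Lemma twist_map_else X p q : ~~ ((p == i) && (q == j)) -> ~~ ((p == j) && (q == i)) ->
  twist_map X p q = X p q.
Proof.
by move=> /negPf pq /negPf qp; rewrite /twist_map !mxE pq qp !mulr0 !addr0.
Qed.

(** A predecessor of [i] would also precede [j], hence be related to both. *)
Let rho_mi m : m != i -> m != j -> rho m i = false.
Proof.
move=> mi mj; apply/negP => rmi; apply: (no_third mi mj); first by rewrite rmi.
by rewrite (proj2 rho_qo _ _ _ rmi rij).
Qed.

Let rho_jm m : m != i -> m != j -> rho j m = false.
Proof.
move=> mi mj; apply/negP => rjm; apply: (no_third mi mj); last by rewrite rjm orbT.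
by rewrite (proj2 rho_qo _ _ _ rij rjm) orbT.
Qed.

Section Isolated.
Hypothesis rji : rho j i.

Let rho_im m : m != i -> m != j -> rho i m = false.
Proof.
move=> mi mj; apply/negP => rim.
by have := proj2 rho_qo _ _ _ rji rim; rewrite rho_jm.
Qed.

Let rho_mj m : m != i -> m != j -> rho m j = false.
Proof.
move=> mi mj; apply/negP => rmj.
by have := proj2 rho_qo _ _ _ rmj rji; rewrite rho_mi.
Qed.

Lemma mul_delta_ji X : A X -> X *m E j i = X j j *: E j i + X i j *: E i i.
Proof.
move=> AX; apply/matrixP => p q; rewrite mulmx_delta !mxE.
have [->|pj] := eqVneq p j; first by rewrite (negPf ji) /=; ring.
have [->|pi] := eqVneq p i; first by rewrite /=; ring.
by rewrite (AX p j) ?rho_mj //=; ring.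
Qed.

Lemma delta_ji_mul X : A X -> E j i *m X = X i i *: E j i + X i j *: E j j.
Proof.
move=> AX; apply/matrixP => p q; rewrite delta_mulmx !mxE.
have [->|qj] := eqVneq q j; first by rewrite (negPf ji) !andbT andbF /=; ring.
have [->|qi] := eqVneq q i; first by rewrite !andbT andbF /=; ring.
by rewrite (AX i q) ?rho_im // !andbF /=; ring.
Qed.

(** Here [i] and [j] are related to no other index, so scaling row and column [i] affects only the
    entries [(i, j)] and [(j, i)]. *)
Lemma twist_map_conj X : A X -> twist_map X =
  diag_mx (\row_p if p == i then u X else 1) *m X *m
  diag_mx (\row_p if p == i then (u X)^-1 else 1).
Proof.
move=> AX; apply/matrixP => p q; rewrite mul_mx_diag mul_diag_mx !mxE.
have [->|pi] := eqVneq p i.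
  have [->|qi] := eqVneq q i.
    by rewrite (negPf ij) /=; field.
  have [->|qj] := eqVneq q j; first by rewrite (negPf ij) /= /al; ring.
  by rewrite (AX i q) ?rho_im //= andbF /=; ring.
have [->|pj] := eqVneq p j.
  have [->|qi] := eqVneq q i; first by rewrite /= /be; ring.
  by rewrite /=; ring.
have [->|qi] := eqVneq q i; first by rewrite (AX p i) ?rho_mi //=; ring.
by rewrite /=; ring.
Qed.

End Isolated.

Lemma mul_delta_ij X : A X -> X *m E i j = X i i *: E i j + X j i *: E j j.
Proof.
move=> AX; apply/matrixP => p q; rewrite mulmx_delta !mxE.
have [->|pi] := eqVneq p i; first by rewrite (negPf ij) /=; ring.
have [->|pj] := eqVneq p j; first by rewrite /=; ring.
by rewrite (AX p i) ?rho_mi //=; ring.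
Qed.

Lemma delta_ij_mul X : A X -> E i j *m X = X j j *: E i j + X j i *: E i i.
Proof.
move=> AX; apply/matrixP => p q; rewrite delta_mulmx !mxE.
have [->|qi] := eqVneq q i; first by rewrite (negPf ij) !andbT andbF /=; ring.
have [->|qj] := eqVneq q j; first by rewrite !andbT andbF /=; ring.
by rewrite (AX j q) ?rho_jm // !andbF /=; ring.
Qed.

(** Commutation of [X] and [Y] makes their vectors of arguments of [u] parallel. By [twist_parallel]
    the correction terms in the two products are then equal, as recorded in [S1], [S2] and [S3]. *)
Lemma twist_map_comm : preserves_commutativity A twist_map.
Proof.
move=> X Y AX AY XY.
have be0 Z : A Z -> ~~ rho j i -> be Z = 0 by move=> AZ /AZ Zji; rewrite /be Zji mulr0.
(* An intermediate [m] contributing to entry [(i, j)] would be a third index. *)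
have no_mid m : m != i -> m != j -> X i m * Y m j = 0 /\ Y i m * X m j = 0.
  move=> mi mj; have [rim|nrim] := boolP (rho i m); last first.
    by rewrite (AX i m) // (AY i m) // !mul0r.
  have nrmj : ~~ rho m j.
    by apply/negP => rmj; apply: (no_third mi mj); rewrite ?rim ?rmj ?orbT.
  by rewrite (AX m j) // (AY m j) // !mulr0.
have XYe p q : (X *m Y) p q = (Y *m X) p q by rewrite XY.
have sum2 (Z W : 'M[R[i]]_n) p q :
    (forall m, m != i -> m != j -> Z p m * W m q = 0) ->
    (Z *m W) p q = Z p i * W i q + Z p j * W j q.
  move=> ZW; rewrite mxE (bigD1 i) //= (bigD1 j) //= big1 ?addr0 // => m /andP[mi mj].
  exact: ZW.
have e_ij : X i i * Y i j + X i j * Y j j = Y i i * X i j + Y i j * X j j.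
  by rewrite -!sum2 // => m mi mj; have [] := no_mid m mi mj.
have e_ji : X j i * Y i i + X j j * Y j i = Y j i * X i i + Y j j * X j i.
  rewrite -!sum2 // => m mi mj; first by rewrite (AY j m) ?mul0r // rho_jm.
  by rewrite (AX j m) ?mul0r // rho_jm.
have e_ii : X i i * Y i i + X i j * Y j i = Y i i * X i i + Y i j * X j i.
  rewrite -!sum2 // => m mi mj; first by rewrite (AX m i) ?mulr0 // rho_mi.
  by rewrite (AY m i) ?mulr0 // rho_mi.
have ab : (X i i - X j j) * Y i j = (Y i i - Y j j) * X i j.
  apply/eqP; rewrite -subr_eq0; move/eqP: e_ij.
  by rewrite -subr_eq0 => /eqP <-; apply/eqP; ring.
have ac : (X i i - X j j) * Y j i = (Y i i - Y j j) * X j i.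
  apply/eqP; rewrite -subr_eq0; move/eqP: e_ji.
  by rewrite eq_sym -subr_eq0 => /eqP <-; apply/eqP; ring.
have bc : X i j * Y j i = Y i j * X j i.
  by apply: (addrI (X i i * Y i i)); rewrite e_ii; ring.
have ex Z W : A Z -> A W -> twist_map Z *m twist_map W = Z *m W +
   (al W * Z i i + al Z * W j j) *: E i j + (be W * Z j j + be Z * W i i) *: E j i
   + (be W * Z i j + al Z * W j i + al Z * be W) *: E i i
   + (al W * Z j i + be Z * W i j + be Z * al W) *: E j j.
  move=> AZ AW; apply: (mul_add_deltas _ _ ij (mul_delta_ij AZ) _ (delta_ij_mul AW)).
    by have [/mul_delta_ji ->//|/(be0 _ AW) ->] := boolP (rho j i); rewrite !scale0r.
  by have [/delta_ji_mul ->//|/(be0 _ AZ) ->] := boolP (rho j i); rewrite !scale0r.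
have S1 : al Y * (X i i - X j j) = al X * (Y i i - Y j j).
  rewrite /al /u; have [->|[z _ _]] := twist_parallel ab ac bc.
    by rewrite -mulrA [Y i j * _]mulrC ab; ring.
  rewrite -mulrA [Y i j * _]mulrC z -mulrA [X i j * _]mulrC -ab z; ring.
have S2 : be Y * (X i i - X j j) = be X * (Y i i - Y j j).
  rewrite /be /u; have [->|[_ z _]] := twist_parallel ab ac bc.
    by rewrite -mulrA [Y j i * _]mulrC ac; ring.
  rewrite -mulrA [Y j i * _]mulrC z -mulrA [X j i * _]mulrC -ac z; ring.
have S3 : be Y * X i j + al X * Y j i + al X * be Y =
          be X * Y i j + al Y * X j i + al Y * be X.
  have -> : be Y * X i j + al X * Y j i + al X * be Y =
            (u X * (u Y)^-1 - 1) * (X i j * Y j i) by rewrite /al /be; ring.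
  have -> : be X * Y i j + al Y * X j i + al Y * be X =
            (u Y * (u X)^-1 - 1) * (Y i j * X j i) by rewrite /al /be; ring.
  rewrite -bc; have [uu|[_ _ ->]] := twist_parallel ab ac bc; last by rewrite !mulr0.
  by rewrite /u uu.
apply: etrans (ex X Y AX AY) _; apply: etrans _ (esym (ex Y X AY AX)).
apply: eq_add4 => //.
- apply/eqP; rewrite -subr_eq0; move/eqP: S1.
  by rewrite -subr_eq0 => /eqP <-; apply/eqP; ring.
- apply/eqP; rewrite -subr_eq0; move/eqP: S2.
  by rewrite eq_sym -subr_eq0 => /eqP <-; apply/eqP; ring.
- apply/eqP; rewrite -subr_eq0; move/eqP: S3; rewrite eq_sym -subr_eq0 => /eqP <-; apply/eqP; ring.
Qed.

(** With [rho j i] the map is pointwise a diagonal conjugation. Otherwise it adds a multiple of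
    [E i j], and since [E i j *m Z] is a multiple of [E i j], this is left multiplication of a unit
    [Z] by a transvection. *)
Lemma twist_map_eigenvalue : preserves_spectrum A twist_map.
Proof.
move=> X AX a; have [rji|nrji] := boolP (rho j i).
  have DD : diag_mx (\row_p if p == i then (u X)^-1 else 1) *m
            diag_mx (\row_p if p == i then u X else 1) = 1%:M.
    apply/matrixP => p q; rewrite mul_diag_mx !mxE.
    have [_|_] := eqVneq p q; last by rewrite mulr0.
    by have [_|_] := eqVneq p i; rewrite ?mulVf ?mulr1.
  rewrite (twist_map_conj rji AX); exact: eigenvalue_conj DD a.
have Zji Z : A Z -> Z j i = 0 by exact.
have unit_imp (Z : 'M[R[i]]_n) (x : R[i]) : A Z -> Z \in unitmx -> Z + x *: E i j \in unitmx.
  move=> AZ Zu.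
  have eZ : E i j *m Z = Z j j *: E i j.
    by rewrite delta_ij_mul // Zji // scale0r addr0.
  have Zjj : Z j j != 0.
    apply/eqP => Zjj; have /matrixP/(_ i j)/eqP : E i j = 0 :> 'M[R[i]]_n.
      by rewrite -[LHS]mulmx1 -(mulmxV Zu) mulmxA eZ Zjj scale0r mul0mx.
    by rewrite !mxE !eqxx oner_eq0.
  have -> : Z + x *: E i j = transv i j (x / Z j j) *m Z.
    by rewrite /transv mulmxDl mul1mx -scalemxAl eZ scalerA divfK.
  rewrite unitmx_mul Zu andbT.
  exact: (proj1 (mulmx1_unit (transvK (x / Z j j) ij))).
have AE : A (E i j) by exact: SMA_delta.
rewrite !eigenvalue_unitmx; congr (~~ _).
have -> : twist_map X - a%:M = X - a%:M + al X *: E i j.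
  by rewrite /twist_map /be Zji // mulr0 scale0r addr0 addrAC.
have AXa : A (X - a%:M) by apply: SMA_sub => //; exact: SMA_scalar.
apply/idP/idP; last exact: unit_imp.
move/(unit_imp _ (- al X) (SMA_line _ AXa AE)).
by rewrite scaleNr addrK.
Qed.

Lemma twist_map_inj : set_inj A twist_map.
Proof.
move=> X Y _ _ XY.
have XYe p q : twist_map X p q = twist_map Y p q by rewrite XY.
have else_eq p q : ~~ ((p == i) && (q == j)) -> ~~ ((p == j) && (q == i)) -> X p q = Y p q.
  by move=> pq qp; rewrite -(twist_map_else X pq qp) -(twist_map_else Y pq qp).
have Xii : X i i = Y i i by apply: else_eq; rewrite eqxx (negPf ij).
have Xjj : X j j = Y j j by apply: else_eq; rewrite eqxx (negPf ji).
have e_ij := XYe i j; have e_ji := XYe j i.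
rewrite (twist_map_ij X) (twist_map_ij Y) in e_ij.
rewrite (twist_map_ji X) (twist_map_ji Y) in e_ji.
have [Xij Xji] : X i j = Y i j /\ X j i = Y j i.
  rewrite /u Xii Xjj in e_ij e_ji; apply: twist_inj e_ji.
  by rewrite mulrC e_ij mulrC.
apply/matrixP => p q.
have [/andP[/eqP-> /eqP->]//|pq] := boolP ((p == i) && (q == j)).
have [/andP[/eqP-> /eqP->]//|qp] := boolP ((p == j) && (q == i)).
exact: else_eq.
Qed.

Lemma twist_map_continuous : continuous twist_map.
Proof.
have c_c p q := @coord_continuous R[i] n n p q.
apply: mx_continuous => p q X.
have d_c : {for X, continuous (fun Y : 'M[R[i]]_n => Y i i - Y j j)}.
  exact: continuousB (c_c i i X) (c_c j j X).
have [/andP[/eqP-> /eqP->]|pq] := boolP ((p == i) && (q == j)).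
  rewrite (_ : (fun _ => _) = (fun Y => Y i j * u Y)).
    exact: continuous_mul_twist d_c (c_c i j X) (c_c j i X).
  by apply/funext => Y; exact: twist_map_ij.
have [/andP[/eqP-> /eqP->]|qp] := boolP ((p == j) && (q == i)).
  rewrite (_ : (fun _ => _) = (fun Y => Y j i * (u Y)^-1)).
    exact: continuous_div_twist d_c (c_c i j X) (c_c j i X).
  by apply/funext => Y; exact: twist_map_ji.
rewrite (_ : (fun _ => _) = (fun Y : 'M[R[i]]_n => Y p q)); first exact: c_c.
by apply/funext => Y; exact: twist_map_else.
Qed.

(** The factor is [2] at [E i j] but [3/2] at [E i j + E i i]. *)
Lemma twist_map_not_linear : ~ linear_on A twist_map.
Proof.
have Aij : A (E i j) by exact: SMA_delta.
have Aii : A (E i i) by apply: SMA_delta; exact: (proj1 rho_qo).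
move=> /(_ 1 _ _ Aij Aii) /matrixP/(_ i j).
rewrite !scale1r [RHS]mxE !twist_map_ij /u /twist !mxE !eqxx (negPf ij) (negPf ji) /=.
rewrite !(addr0, add0r, subr0, sub0r, mulr0, mul0r, normr0, normr1, mul1r, mulr1, subrr, divr1).
rewrite oppr0 normr0 add0r invr1 => /addrI /(congr1 GRing.inv).
by rewrite invrK invr1 => /eqP; rewrite -subr_eq0 addrK oner_eq0.
Qed.

End TwistMap.

(** * The cardinality condition and the equivalence *)

Lemma mem_related (n : nat) (rho : rel 'I_n) (i j m : 'I_n) :
  (m \in ((rimage rho i :|: rpreimage rho i) :&:
           (rimage rho j :|: rpreimage rho j))%SET) =
  (rho m i || rho i m) && (rho m j || rho j m).
Proof. by rewrite !inE ![rho _ m || _]orbC. Qed.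

Lemma has_thirdP (n : nat) (rho : rel 'I_n) : quasi_order rho ->
  (forall i j : 'I_n, rho i j -> i != j ->
     (3 <= #|((rimage rho i :|: rpreimage rho i) :&:
              (rimage rho j :|: rpreimage rho j))%SET|)%N)
  <-> has_third rho.
Proof.
move=> [rho_refl _]; split=> third i j rij ij.
all: have ji : j != i by rewrite eq_sym.
  have := third i j rij ij; set S := finset.setI _ _.
  have iS : i \in S by rewrite /S mem_related rho_refl rij.
  have jS : j \in S by rewrite /S mem_related rho_refl rij orbT.
  rewrite (cardsD1 i) iS (cardsD1 j) in_setD1 ji jS !add1n !ltnS.
  case/card_gt0P => m; rewrite !in_setD1 mem_related.
  by case/and3P=> mj mi /andP[mi' mj']; exists m.
have [m [mi mj rmi rmj]] := third i j rij ij; set S := finset.setI _ _.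
have iS : i \in S by rewrite /S mem_related rho_refl rij.
have jS : j \in S by rewrite /S mem_related rho_refl rij orbT.
have mS : m \in S by rewrite /S mem_related rmi rmj.
by rewrite (cardsD1 i) iS (cardsD1 j) in_setD1 ji jS (cardsD1 m) !in_setD1 mi mj mS.
Qed.

Unset Implicit Arguments.

Theorem theorem3p7 (R : realType) (n : nat) (n_ge1 : (1 <= n)%N)
    (rho : rel 'I_n) (rho_qo : quasi_order rho) :
  (forall i j : 'I_n, rho i j -> i != j ->
     (3 <= #|((rimage rho i :|: rpreimage rho i) :&:
              (rimage rho j :|: rpreimage rho j))%SET|)%N)
  <->
  (forall phi : 'M[R[i]]_n -> 'M[R[i]]_n,
     {within SMA R rho, continuous phi} ->
     set_inj (SMA R rho) phi ->
     preserves_commutativity (SMA R rho) phi ->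
     preserves_spectrum (SMA R rho) phi ->
     jordan_embedding (SMA R rho) phi).
Proof.
rewrite has_thirdP //; split=> [third phi phi_c phi_inj phi_comm phi_spec|all_jordan i j rij ij].
  apply: admissible_jordan => //; split=> // X Y p q AX AY.
  exact: line_continuous phi_c AX AY.
(* If the third index is missing, [twist_map i j] meets every hypothesis of (ii) and contradicts
   linearity. *)
apply: contrapT => /forallNP no_third.
have no_third' m : m != i -> m != j ->
    rho m i || rho i m -> rho m j || rho j m -> False.
  by move=> mi mj rmi rmj; apply: (no_third m).
have [_ lin _] := all_jordan (twist_map i j)
  (continuous_subspaceT (@twist_map_continuous R n i j ij))
  (twist_map_inj ij) (twist_map_comm rho_qo rij ij no_third')
  (twist_map_eigenvalue rho_qo rij ij no_third').
exact: twist_map_not_linear rho_qo rij ij lin.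
Qed.
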